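(* Let $G=K\rtimes H$ be a (finite) Frobenius group with kernel $K$ and complement $H$. Then the divisibility graph $D(\mathrm{cs}(G))$ has exactly two connected components.
   Context: For a finite group $G$, $\mathrm{cs}(G)$ denotes the set of conjugacy class sizes of $G$. For a finite set $X$ of positive integers, the divisibility graph $D(X)$ has as vertices the elements of $X$ not equal to $1$, with distinct vertices $a,b$ joined by an edge iff $a\mid b$ or $b\mid a$. *)

(* Defs.v *)
From mathcomp Require Import all_boot all_fingroup all_solvable.
From mathcomp Require Import finmap.

Set Implicit Arguments.
Unset Strict Implicit.
Unset Printing Implicit Defensive.

Definition cs (gT : finGroupType) (G : {group gT}) : {fset nat} :=
  [fset #|(x ^: G)%g| | x in G]%fset.

Section DivisibilityGraph.

Variable X : {fset nat}.

Definition div_vertex : finType := (X `\ 1%N)%fset.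

Definition div_edge : rel div_vertex :=
  [rel a b | (a != b) && ((val a %| val b) || (val b %| val a))].

(* n_comp counts one representative per class of connect div_edge, i.e. the
   connected components, because div_edge is symmetric. *)
Definition div_graph_ncomp : nat := n_comp div_edge div_vertex.

End DivisibilityGraph.

(* Main.v *)
Require Import Defs.
From mathcomp Require Import all_boot all_fingroup all_solvable.
From mathcomp Require Import finmap.
From mathcomp Require Import ssralg zmodp mxrepresentation mxabelem.

(** A nontrivial element of K has its centraliser inside K, so its class size
    is a multiple of #|G : K| = #|H|; an element outside K is conjugate to a
    nontrivial element of H, whose centraliser lies inside H, so its class size
    is a multiple of #|G : H| = #|K|. As #|K| and #|H| are coprime, a multiple
    of both is a multiple of #|G|, which no class size is unless G is trivial.
    Divisibility therefore never links the two kinds of class sizes, and what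
    remains is that each kind is connected. If 'Z(K) contains z != 1 then z has
    class size exactly #|H|, and this vertex is adjacent to every other vertex
    of its kind; likewise for 'Z(H) and #|K|. So the theorem amounts to
    'Z(K) != 1 and 'Z(H) != 1.

    Both facts use one identity (semiregular_trace_cent): if X acts
    semiregularly on R, the conjugates of X partition the elements of R X
    outside R, so on a module on which the sum over X vanishes, #|R| acts as the
    sum over R; hence R acts trivially in the coprime case.

    'Z(K) != 1 is Thompson's theorem that K, having a fixed-point-free
    automorphism of prime order, is nilpotent (Thompson_kernel_nilpotent). In a
    minimal counterexample no nontrivial p-subgroup invariant under the
    automorphism is normal, so the normalisers of such subgroups are nilpotent.
    Thompson's p-complement theorem (Thompson_p_complement) says that for odd p
    two of these normalisers, those of the Thompson subgroup and of the socle of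
    the centre of a Sylow p-subgroup, control p-nilpotency of K; and a
    nontrivial normal p-complement would be nilpotent, hence contain a
    nontrivial invariant normal q-subgroup. The p-complement theorem rests on
    the criterion of Frobenius (Frobenius_pprime_gen), obtained by transfer, and
    on coprime_offender: for p odd, an elementary abelian p-group A acting
    faithfully on an abelian p'-group Q has fixed points of index greater than
    #|A| on every faithful module of characteristic p for Q A, whereas
    maximality of the rank of A forces the opposite bound.

    For 'Z(H), if #|H| is even then an involution of H inverts K, hence is
    unique and central. If #|H| is odd, its Sylow subgroups are cyclic and its
    subgroups of prime order commute as soon as one normalises the other; then
    an element of order p, for p the least prime divisor of #|H|, is central
    (odd_compl_center). *)

Set Implicit Arguments.
Unset Strict Implicit.
Unset Printing Implicit Defensive.

Import GRing.Theory FiniteModule.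
Local Open Scope group_scope.

(** * Semiregular coprime action on an abelian group *)

Section Trace.

Variables (gT : finGroupType) (V X : {group gT}).
Hypotheses (abV : abelian V) (nVX : X \subset 'N(V)).

Let tr (u : fmod_of abV) : fmod_of abV := (\sum_(x in X) u ^@ x)%R.

(** Sum u ^@ (x ^ y) over y in R and x in X. Each inner sum over x is the
    trace conjugated by y, hence 0. Summing over y first instead, x = 1
    contributes #|R| copies of u, while for x != 1 the map y |-> [~ x, y] is a
    permutation of R, so x contributes the R-trace of u ^@ x; together these
    give minus the R-trace of u. So #|R| u is the R-trace of u, which R fixes,
    and #|R| is invertible on V. *)
Lemma semiregular_trace_cent (R : {group gT}) :
    R \subset 'N(V) -> X \subset 'N(R) -> coprime #|V| #|R| ->
    semiregular R X -> (forall u, tr u = 0%R) ->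
  R \subset 'C(V).
Proof.
move=> nVR nRX coVR regRX tr0.
have nV x : x \in X -> x \in 'N(V) by apply: subsetP.
have nVy y : y \in R -> y \in 'N(V) by apply: subsetP.
have nR x y : x \in X -> y \in R -> y ^ x \in R.
  by move=> Xx Ry; rewrite memJ_norm ?(subsetP nRX).
pose T (u : fmod_of abV) : fmod_of abV := (\sum_(y in R) u ^@ y)%R.
have Tfix u y : y \in R -> (T u ^@ y = T u)%R.
  move=> Ry; rewrite {2}/T (reindex_acts 'R _ Ry) /=; last first.
    by apply/actsP=> z Rz w; rewrite /= groupMr.
  by rewrite /T actr_sum; apply: eq_bigr => z Rz; rewrite actrM ?nVy.
have RT u : (u *+ #|R| = T u)%R.
  have sum0 : (\sum_(y in R) \sum_(x in X) u ^@ (x ^ y) = 0)%R.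
    apply: big1 => y Ry; transitivity (tr (u ^@ y^-1) ^@ y)%R.
      rewrite /tr actr_sum; apply: eq_bigr => x Xx.
      have [Nx Ny] := (nV x Xx, nVy y Ry).
      by rewrite conjgE !actrM ?groupM ?groupV.
    by rewrite tr0 act0r.
  have tr1 : (\sum_(x in X^#) u ^@ x = - u)%R.
    apply/eqP; rewrite eq_sym -subr_eq0 -opprD oppr_eq0.
    have := tr0 u; rewrite /tr (big_setD1 1%g) //= actr1 => ->.
    by rewrite eqxx.
  move: sum0; rewrite exchange_big (big_setD1 1%g) //=.
  rewrite (eq_bigr (fun=> u)) => [|y Ry]; last by rewrite conj1g actr1.
  rewrite sumr_const (eq_bigr (fun x => T (u ^@ x)%R)) => [|x Xx].
    rewrite exchange_big /= (eq_bigr (fun y => - (u ^@ y))%R) => [|y Ry].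
      by rewrite sumrN => /eqP; rewrite subr_eq0 => /eqP.
    by rewrite -actNr -tr1 -actr_sum.
  have [ntx {}Xx] := setD1P Xx.
  (* Semiregularity makes y |-> [~ x, y] injective, as x ^ y determines y. *)
  have injx : {in R &, injective (fun y => [~ x, y])}.
    move=> y z Ry Rz /= /mulgI eq_yz.
    have czy : commute x (z * y^-1).
      by apply/commgP/conjg_fixP; rewrite conjgM -eq_yz conjgK.
    apply/eqP; rewrite eq_sym eq_mulgV1 -in_set1 -[[set 1]](regRX x).
      by rewrite inE groupM ?groupV //=; apply/cent1P.
    by rewrite !inE ntx.
  have imx : [set [~ x, y] | y in R] = R.
    apply/eqP; rewrite eqEcard card_in_imset // leqnn andbT.
    apply/subsetP=> _ /imsetP[y Ry ->]; rewrite commgEr groupM //.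
    by rewrite nR ?groupV.
  rewrite /T -{2}imx big_imset //=; apply: eq_bigr => y Ry.
  have Rxy : [~ x, y] \in R by rewrite -imx imset_f.
  by rewrite conjg_mulR actrM ?(nVy _ Rxy) ?nV.
apply/centsP=> y Ry v Vv; apply: commute_sym; apply/commgP/conjg_fixP.
have eqR : (fmod abV (v ^ y) *+ #|R| = fmod abV v *+ #|R|)%R.
  by rewrite fmodJ ?nVy // -actZr RT Tfix.
have Vvy : v ^ y \in V by rewrite memJ_norm ?nVy.
have: (v ^ y) ^+ #|R| = v ^+ #|R|.
  by rewrite -{1}(fmodK abV Vvy) -{2}(fmodK abV Vv) -!fmvalZ eqR.
by move/(congr1 (fun w => w ^+ expg_invn V #|R|)); rewrite !expgK.
Qed.

Lemma trace_fixed u x : x \in X -> (tr u ^@ x = tr u)%R.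
Proof.
move=> Xx; rewrite {2}/tr (reindex_acts 'R _ Xx) /=; last first.
  by apply/actsP=> z Rz w; rewrite /= groupMr.
by rewrite /tr actr_sum; apply: eq_bigr => z Rz; rewrite actrM ?(subsetP nVX).
Qed.

(** A trace is fixed by X, so it vanishes when X has no fixed point on V. *)
Lemma semiregular_TI_cent (R : {group gT}) :
    R \subset 'N(V) -> X \subset 'N(R) -> coprime #|V| #|R| ->
    semiregular R X -> 'C_V(X) = 1 -> R \subset 'C(V).
Proof.
move=> nVR nRX coVR regRX cVX1.
apply: semiregular_trace_cent => // u; apply: val_inj; apply/set1P.
rewrite fmval0 -[[set _]]cVX1 inE fmodP; apply/centP=> x Xx.
apply/commgP/conjg_fixP.
by rewrite -fmvalJ ?(subsetP nVX) // trace_fixed.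
Qed.

(** When X acts quadratically, d x = u ^@ x - u satisfies d x^-1 = - d x, so
    the sum D of the d x is its own opposite and vanishes as p is odd; and the
    trace of u is #|X| u + D = 0. *)
Lemma semiregular_quadratic_cent p (R : {group gT}) :
    prime p -> odd p -> p.-abelem V -> #|X| = p ->
    R \subset 'N(V) -> X \subset 'N(R) -> p^'.-group R ->
    semiregular R X -> [~: V, X, X] = 1 -> R \subset 'C(V).
Proof.
move=> p_pr odd_p abelV oX nVR nRX p'R regRX VXX1.
have [pV _] := andP abelV.
apply: semiregular_trace_cent => // [|u]; first exact: pnat_coprime pV p'R.
have nV x : x \in X -> x \in 'N(V) by apply: subsetP.
pose d x : fmod_of abV := (u ^@ x - u)%R.
have fix_d x z : x \in X -> z \in X -> (d x ^@ z = d x)%R.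
  move=> Xx Xz; apply: val_inj; rewrite fmvalJ ?nV //.
  have <- : [~ val u, x] = val (d x).
    by rewrite /d addrC fmvalA fmvalN fmvalJ ?nV.
  apply/conjg_fixP/eqP/set1P; rewrite -[[set 1]]VXX1 mem_commg //.
  by rewrite mem_commg ?fmodP.
have dV x : x \in X -> (d x^-1%g = - d x)%R.
  move=> Xx; rewrite -[in RHS](fix_d x x^-1%g) ?groupV // /d actAr actNr.
  by rewrite actrK opprB.
pose D := (\sum_(x in X) d x)%R.
have Vp (w : fmod_of abV) : (w *+ p = 0)%R.
  apply: val_inj; rewrite fmvalZ fmval0.
  by have [_ ->] := (abelemP p_pr abelV); rewrite ?fmodP.
have DN : (D = - D)%R.
  rewrite -sumrN /D (reindex_inj invg_inj) /=.
  apply: eq_big => [x | x Xx]; first by rewrite groupV.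
  by rewrite dV // -[x]invgK groupV.
have D0 : D = 0%R.
  have D2 : (D *+ 2 = 0)%R by rewrite mulr2n {1}DN addNr.
  rewrite -(Vp D) -(odd_double_half p) odd_p addnC -muln2 mulnC.
  by rewrite mulrnDr mulrnA D2 mul0rn add0r mulr1n.
rewrite -[tr u](subrK (u *+ #|X|)%R) {2}oX Vp addr0.
by rewrite -sumr_const -sumrB.
Qed.

End Trace.

(** * The normal p-complement criterion of Frobenius *)

Lemma commute_conjg (gT : finGroupType) (x y : gT) : commute x y -> x ^ y = x.
Proof. by move=> cxy; rewrite conjgE cxy mulKg. Qed.

(** Every p-local automiser of G is a p-group; by p_local_centP this says that
    p'-elements normalising a p-subgroup centralise it. The condition is
    equivalent to p-nilpotency (Frobenius_pprime_gen is the hard direction), and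
    it can be tested on one p-subgroup at a time. *)
Definition p_local_cent (gT : finGroupType) (p : nat) (G : {set gT}) :=
  [forall (X : {group gT} | (X \subset G) && p.-group X),
     p.-group ('N_G(X) / 'C_G(X))].

(** The subgroup usually written O^p(G), the smallest normal subgroup of
    p-power index; it is a p'-group exactly when G has a normal
    p-complement. *)
Definition pprime_gen (gT : finGroupType) (p : nat) (G : {set gT}) :=
  <<[set y in G | p^'.-elt y]>>.

Section LocalCent.

Variables (gT : finGroupType) (p : nat).
Implicit Types G H E X P D S : {group gT}.

Canonical pprime_gen_group G := [group of pprime_gen p G].

Lemma not_pgroup_prime_dvd G :
  ~~ p.-group G -> exists q, [/\ prime q, q != p & q %| #|G|].
Proof.
move=> not_pG; pose q := pdiv #|G| `_p^'.
have part_gt1 : 1 < #|G| `_p^'.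
  rewrite ltn_neqAle part_gt0 andbT eq_sym; apply: contra not_pG.
  by rewrite partn_eq1 ?cardG_gt0 // pnatNK.
have q_pr : prime q := pdiv_prime part_gt1.
exists q; split=> //; last by rewrite (dvdn_trans (pdiv_dvd _)) ?dvdn_part.
have: q \in p^'.
  apply: (pnatPpi (part_pnat p^' #|G|)).
  by rewrite mem_primes q_pr part_gt0 pdiv_dvd.
by rewrite !inE.
Qed.

Lemma pgroup_quotient_gen G E :
    prime p -> G \subset 'N(E) ->
    (forall y, y \in G -> p^'.-elt y -> y \in E) ->
  p.-group (G / E).
Proof.
move=> p_pr nEG p'E; apply/pgroupP=> q q_pr.
case/(Cauchy q_pr)=> _ /morphimP[x Nx Gx ->].
have Ex' : x.`_p^' \in E by apply: p'E; rewrite ?groupX ?p_elt_constt.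
have Np : x.`_p \in 'N(E) by rewrite groupX.
rewrite -{1}(consttC p x) mkerr ?ker_coset //=.
move=> oq; have: p.-elt (coset E x.`_p).
  by rewrite morph_p_elt ?groupX ?p_elt_constt.
by rewrite /p_elt oq pnatE.
Qed.

Lemma pgroup_quotient_mem G E y :
    G \subset 'N(E) -> p.-group (G / E) -> y \in G -> p^'.-elt y -> y \in E.
Proof.
move=> nEG pGE Gy p'y; have Ny := subsetP nEG y Gy.
apply: coset_idr => //; apply/eqP; rewrite -order_eq1.
have := mem_p_elt pGE (mem_quotient E Gy).
rewrite /p_elt => /pnat_1 -> //; exact: (morph_p_elt (coset_morphism E)).
Qed.

Lemma p_local_centP G :
  prime p ->
  reflect (forall X y, X \subset G -> p.-group X -> y \in 'N_G(X) ->
             p^'.-elt y -> y \in 'C(X))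
          (p_local_cent p G).
Proof.
have nCN X := normal_norm (subcent_normal G X).
move=> p_pr; apply: (iffP forall_inP) => [lcG X y sXG pX Ny p'y | lcG X].
  have pNC : p.-group ('N_G(X) / 'C_G(X)) by apply: lcG; rewrite sXG.
  by have /setIP[] := pgroup_quotient_mem (nCN X) pNC Ny p'y.
case/andP=> sXG pX; apply: pgroup_quotient_gen (nCN X) _ => //.
by move=> y Ny p'y; have /setIP[Gy _] := Ny; rewrite inE Gy (lcG X).
Qed.

Lemma p_local_centS G H :
  prime p -> H \subset G -> p_local_cent p G -> p_local_cent p H.
Proof.
move=> p_pr sHG /(p_local_centP _ p_pr) lcG; apply/(p_local_centP _ p_pr).
move=> X y sXH pX /setIP[Hy nXy] p'y.
by apply: lcG => //; rewrite ?(subset_trans sXH) // inE (subsetP sHG).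
Qed.

Lemma p_local_centJ G x :
  prime p -> p_local_cent p G -> p_local_cent p (G :^ x).
Proof.
move=> p_pr /(p_local_centP _ p_pr) lcG; apply/(p_local_centP _ p_pr).
move=> X y sXG pX /setIP[Gy nXy] p'y.
rewrite -(conjgKV x y) -(conjsgKV x X) centJ memJ_conjg.
apply: lcG; first by rewrite sub_conjgV.
- by rewrite pgroupJ.
- by rewrite inE -mem_conjg Gy normJ memJ_conjg.
by rewrite p_eltJ.
Qed.

Lemma nilpotent_p_local_cent G : prime p -> nilpotent G -> p_local_cent p G.
Proof.
move=> p_pr nilG; apply/(p_local_centP _ p_pr) => X y sXG pX /setIP[Gy _] p'y.
rewrite -cycle_subG (sub_nilpotent_cent2 nilG) ?cycle_subG //.
exact: pnat_coprime pX p'y.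
Qed.

Lemma pprime_gen_norm G : 'N(G) \subset 'N(pprime_gen p G).
Proof.
apply: norms_gen; apply/subsetP=> x nGx; rewrite inE.
apply/subsetP=> _ /imsetP[y /setIdP[Gy p'y] ->].
by rewrite !inE memJ_norm // Gy p_eltJ.
Qed.

Lemma pprime_gen_normal G : pprime_gen p G <| G.
Proof.
rewrite /normal (subset_trans (normG G) (pprime_gen_norm G)) andbT gen_subG.
by apply/subsetP=> y; rewrite inE => /andP[].
Qed.

Lemma pprime_gen_quotient G : prime p -> p.-group (G / pprime_gen p G).
Proof.
move=> p_pr; apply: pgroup_quotient_gen => //.
  exact: normal_norm (pprime_gen_normal G).
by move=> y Gy p'y; rewrite mem_gen // inE Gy.
Qed.

Lemma local_norm_mul G D S :
    p_local_cent p G -> D \subset G -> p.-group D -> p.-Sylow('N_G(D)) S ->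
  S * 'C_G(D) = 'N_G(D).
Proof.
move=> lcG sDG pD sylS; set N := 'N_G(D); set C := 'C_G(D).
have nCN : N \subset 'N(C) := normal_norm (subcent_normal G D).
have pNC : p.-group (N / C) by apply: (forall_inP lcG); rewrite sDG.
have sSN := pHall_sub sylS; have nCS := subset_trans sSN nCN.
have /pHall_id defS := quotient_pHall nCS sylS.
apply/eqP; rewrite eqEsubset mulG_subG sSN setIS ?cent_sub //= -/C -/N.
by rewrite (normC nCS) -quotientSK // (defS pNC).
Qed.

(** Alperin-style induction on the index of P :&: S = D in P. Both 'N_P(D) and
    'N_S(D) properly contain D, and the Sylow subgroups of 'N_G(D) containing
    them are conjugate under 'C_G(D) by local_norm_mul; a Sylow subgroup of G
    containing the first is then closer to P, and its conjugate closer to S,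
    than P is to S. *)
Lemma Sylow_conj_cent G P S :
    p_local_cent p G -> p.-Sylow(G) P -> p.-Sylow(G) S ->
  exists2 c, c \in 'C_G(P :&: S) & S :=: P :^ c.
Proof.
move=> lcG; move: {2}_.+1 (ltnSn (#|P| - #|P :&: S|)) => n.
elim: n => // n IHn in P S *; rewrite ltnS => le_n sylP sylS.
have [[sPG pP _] [sSG pS _]] := (and3P sylP, and3P sylS).
have oPS : #|P| = #|S| by rewrite (card_Hall sylP) (card_Hall sylS).
pose D := (P :&: S)%G.
have [sDP sDS] : D \subset P /\ D \subset S by rewrite subsetIl subsetIr.
have [/eqP PS | prDP] := boolP (P :==: S).
  by exists 1; rewrite ?group1 // conjsg1.
have {}prDP : D \proper P.
  rewrite properEneq sDP andbT; apply: contraNneq prDP => /setIidPl sPS.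
  by rewrite eqEcard sPS oPS /=.
have prDS : D \proper S.
  by rewrite properEcard sDS -oPS proper_card.
have pD : p.-group D := pgroupS sDP pP.
have sDG := subset_trans sDP sPG.
have step (A : {group gT}) : p.-group A -> A \subset G -> D \proper A ->
    exists2 B : {group gT}, p.-Sylow('N_G(D)) B
      & D \proper 'N_A(D) /\ 'N_A(D) \subset B.
  move=> pA sAG prDA; have nilA := pgroup_nil pA.
  have [||B sylB sB] := @Sylow_superset p _ 'N_G(D)%G 'N_A(D)%G.
    by rewrite setSI.
    by rewrite (pgroupS (subsetIl A _) pA).
  by exists B => //; split=> //; apply: nilpotent_proper_norm.
have [S1 sylS1 [prN1 sN1]] := step P pP sPG prDP.
have [S2 sylS2 [prN2 sN2]] := step S pS sSG prDS.
have [m Nm defS2] := Sylow_trans sylS1 sylS2.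
have /mulsgP[s c Ss Cc def_m] : m \in S1 * 'C_G(D) by rewrite local_norm_mul.
have {m Nm def_m}defS2 : S2 :=: S1 :^ c by rewrite defS2 def_m conjsgM conjGid.
have sS1G : S1 \subset G.
  by rewrite (subset_trans (pHall_sub sylS1)) ?subsetIl.
have [T sylT sS1T] := Sylow_superset sS1G (pHall_pgroup sylS1).
have [Gc cDc] := setIP Cc.
have closer (A B E : {group gT}) : #|A| = #|P| -> D \proper E ->
    E \subset A :&: B -> #|A| - #|A :&: B| < n.
  move=> -> prE sEAB; apply: leq_trans le_n.
  have ltDAB := leq_trans (proper_card prE) (subset_leq_card sEAB).
  by rewrite ltn_sub2l ?(proper_card prDP).
have sPT : 'N_P(D) \subset P :&: T.
  by rewrite subsetI subsetIl (subset_trans sN1).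
have [x /setIP[Gx cx] defT] :=
  IHn P T (closer _ _ _ erefl prN1 sPT) sylP sylT.
have sTS : 'N_S(D) \subset T :^ c :&: S.
  by rewrite subsetI subsetIl andbT (subset_trans sN2) // defS2 conjSg.
have sylTc : p.-Sylow(G) (T :^ c) by rewrite pHallJ.
have oTc : #|T :^ c| = #|P| by rewrite cardJg (card_Hall sylT) (card_Hall sylP).
have [y /setIP[Gy cy] defS] :=
  IHn (T :^ c)%G S (closer _ _ _ oTc prN2 sTS) sylTc sylS.
exists (x * c * y); last by rewrite !conjsgM -defT.
have cDx : x \in 'C(D).
  by apply: (subsetP (centS _)) cx; apply: subset_trans (proper_sub prN1) sPT.
have cDy : y \in 'C(D).
  by apply: (subsetP (centS _)) cy; apply: subset_trans (proper_sub prN2) sTS.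
by rewrite !groupM // inE ?Gx ?Gc ?Gy.
Qed.

(** P and P :^ g are conjugate by some c centralising x ^ g, so g may be
    replaced by g * c^-1, which lies in 'N_G(P) = P * 'C_G(P). *)
Lemma Sylow_control_fusion G P x g :
    p_local_cent p G -> p.-Sylow(G) P -> x \in P -> g \in G -> x ^ g \in P ->
  exists2 h, h \in P & x ^ h = x ^ g.
Proof.
move=> lcG sylP Px Gg Pxg; have [sPG pP _] := and3P sylP.
have sylPg : p.-Sylow(G) (P :^ g) by rewrite pHallJ.
have [c /setIP[Gc cPc] defPg] := Sylow_conj_cent lcG sylP sylPg.
have : g * c^-1 \in 'N_G(P).
  by rewrite inE groupM ?groupV //=; apply/normP; rewrite conjsgM defPg conjsgK.
have sylPN : p.-Sylow('N_G(P)) P.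
  by apply: pHall_subl sylP; rewrite ?subsetIl // subsetI sPG normG.
rewrite -(local_norm_mul lcG sPG pP sylPN).
case/mulsgP=> h z Ph /setIP[_ cz] def_gc.
exists h => //; have cxg : (x ^ g) ^ c^-1 = x ^ g.
  apply: commute_conjg; apply: commute_sym.
  by apply: (centP (groupVr cPc)); rewrite inE Pxg memJ_conjg.
rewrite -cxg -conjgM def_gc conjgM; apply/esym/commute_conjg/commute_sym.
by apply: (centP cz); rewrite groupJ.
Qed.

(** Let N be O^p(G) and Q = N :&: P. By Sylow_control_fusion, N-conjugate
    elements of Q are congruent modulo F = [~: Q, P], so the transfer of N into
    the abelian p-group Q / F sends g in Q to the #|N : Q|-th power of its
    coset. But N, being generated by p'-elements, is in the kernel of the
    transfer; so Q = [~: Q, P], and Q = 1 since P is nilpotent. *)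
Theorem Frobenius_pprime_gen G :
  p_local_cent p G -> p^'.-group (pprime_gen p G).
Proof.
move=> lcG; have [P sylP] := Sylow_exists p G; have [sPG pP _] := and3P sylP.
pose N := pprime_gen_group G; have nsNG : N <| G := pprime_gen_normal G.
have [sNG nNG] := andP nsNG.
pose Q := (N :&: P)%G.
have sylQ : p.-Sylow(N) Q := Sylow_setI_normal nsNG sylP.
have [sQN pQ _] := and3P sylQ; have sQP : Q \subset P := subsetIr _ _.
have nQP : P \subset 'N(Q) by rewrite normsI ?normG // (subset_trans sPG).
suffices Q1 : Q :=: 1.
  by rewrite /pgroup -partn_eq1 ?cardG_gt0 // -(card_Hall sylQ) Q1 cards1.
apply/eqP; apply: contraT => ntQ.
have /andP[_ /negP[]] : [~: Q, P] \proper Q.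
  by rewrite (nil_comm_properl (pgroup_nil pP)) // subsetI subxx.
set F := [~: Q, P]; have sFQ : F \subset Q by rewrite commg_subl.
have nFP : P \subset 'N(F) by rewrite commg_normr.
have nFQ := subset_trans sQP nFP.
pose alpha := restrm_morphism nFQ (coset_morphism F).
have abA : abelian (alpha @* Q).
  rewrite morphim_restrm setIid -[_ @* _]/(Q / F) sub_der1_abelian //.
  exact: commgS.
have tr0 g : g \in N -> transfer N abA g = 0%R.
  suffices /subsetP kerN : N \subset 'ker (transfer_morphism N abA).
    by move=> Ng; apply: (mker (kerN g Ng)).
  rewrite gen_subG; apply/subsetP=> y /setIdP[Gy p'y].
  have Ny : y \in N by rewrite mem_gen // inE Gy.
  apply/kerP=> //; apply: val_inj; apply/eqP; rewrite -order_eq1; apply/eqP.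
  set u := transfer_morphism N abA y.
  apply: (@pnat_1 p).
    have pA : p.-group (alpha @* Q) by rewrite morphim_pgroup.
    exact: mem_p_elt pA (fmodP u).
  apply: (morph_p_elt (fmval_morphism abA)); first by rewrite inE.
  exact: morph_p_elt.
apply/subsetP=> g Qg; have Ng := subsetP sQN g Qg.
have trX := transversalP (rcosets_cycle_partition sQN Ng).
set X := transversal _ _ in trX.
have := transfer_cycle_expansion sQN abA Ng trX.
(* Each term of the cycle expansion is congruent to a power of g, and the
   exponents add up to #|N : Q|. *)
rewrite tr0 // (eq_bigr (fun x => fmod abA (coset F g) *+ #|<[g]> : Q :* x|)%R).
  rewrite sumrMnr (sum_index_rcosets_cycle sQN Ng trX) => tr_g.
  have Ag : coset F g \in alpha @* Q.
    by rewrite -[coset F g]/(alpha g) mem_morphim.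
  have coAN : coprime #|alpha @* Q| #|N : Q|.
    have pA : p.-group (alpha @* Q) by rewrite morphim_pgroup.
    by apply: pnat_coprime pA _; case/and3P: sylQ.
  apply: coset_idr; first exact: subsetP nFQ g Qg.
  rewrite -(expgK coAN Ag) -(fmodK abA Ag) -fmvalZ -tr_g fmval0.
  by rewrite expg1n.
move=> x Xx; have Nx : x \in N := subsetP (transversal_sub trX) x Xx.
set n := #|_ : _|; set z := (g ^+ n) ^ x^-1.
have Qz : z \in Q.
  by rewrite /z conjgE invgK mulgA -mem_rcoset mulg_exp_card_rcosets.
have [] := @Sylow_control_fusion G P (g ^+ n) x^-1 lcG sylP.
- by rewrite (subsetP sQP) ?groupX.
- by rewrite groupV (subsetP sNG).
- by rewrite (subsetP sQP).
move=> h Ph def_z; rewrite -fmodX; last first.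
  by rewrite -[coset F g]/(alpha g) mem_morphim.
change (fmod abA (coset F z) = fmod abA (coset F g ^+ n)); congr (fmod _ _).
rewrite /z -def_z conjg_mulR mkerr ?ker_coset.
- by rewrite morphX ?(subsetP nFQ).
- by rewrite groupX ?(subsetP nFQ).
by rewrite mem_commg ?groupX.
Qed.

End LocalCent.

(** * Elementary abelian groups acting on modules in odd characteristic *)

Section Coprime.

Variable gT : finGroupType.
Implicit Types A B G H K Q R V X : {group gT}.

Lemma coprime_comm_cent_mul A G :
    A \subset 'N(G) -> coprime #|G| #|A| -> solvable G ->
  [~: G, A] * 'C_G(A) = G.
Proof.
move=> nGA coGA solG; set K := [~: G, A].
have sKG : K \subset G by rewrite commg_subl.
have nKG : G \subset 'N(K) by rewrite commg_norml.
have nKA : A \subset 'N(K) by rewrite commg_normr.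
apply/eqP; rewrite eqEsubset mulG_subG sKG subsetIl /= -quotientSK //.
rewrite coprime_quotient_cent // subsetI subxx /=.
by rewrite quotient_cents2r.
Qed.

Lemma coprime_comm_cent A G :
    A \subset 'N(G) -> coprime #|G| #|A| -> solvable G ->
  [~: G, A] \subset 'C(A) -> G \subset 'C(A).
Proof.
move=> nGA coGA solG cKA.
by rewrite -(coprime_comm_cent_mul nGA coGA solG) mulG_subG cKA subsetIr.
Qed.

(** The A x B lemma of Thompson for abelian V. As R is coprime to V and fixes
    'C_V(X), the X-invariant group [~: V, R] meets 'C_V(X) trivially; a p-group
    without fixed points on a p-group acts on the trivial group. *)
Lemma cent_coprime_times (p : nat) V R X :
    abelian V -> p.-group V -> p.-group X -> p^'.-group R ->
    R \subset 'N(V) -> X \subset 'N(V) -> X \subset 'C(R) ->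
    R \subset 'C('C_V(X)) -> R \subset 'C(V).
Proof.
move=> abV pV pX p'R nVR nVX cRX cRW.
have coVR : coprime #|V| #|R| := pnat_coprime pV p'R.
have sWV : [~: V, R] \subset V by rewrite commg_subl.
have nWX : X \subset 'N([~: V, R]) by apply: normsR => //; apply: cents_norm.
rewrite centsC; apply/commG1P/eqP; apply: contraT => ntW.
have pWX : p.-group ([~: V, R] <*> X).
  rewrite norm_joinEr // pgroupM (pgroupS sWV pV); exact: pX.
have nsW : [~: V, R] <| [~: V, R] <*> X by rewrite normalYl.
case/eqP: (meet_center_nil (pgroup_nil pWX) nsW ntW).
apply/trivgP; rewrite -(coprime_abel_cent_TI nVR coVR abV).
rewrite subsetI subsetIl /= centsC (subset_trans cRW) // centS //.
rewrite subsetI (subset_trans (subsetIl _ _) sWV) /=.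
by rewrite (subset_trans (subsetIr _ _)) // subIset // centS ?orbT ?joing_subr.
Qed.

(** An irreducible module yields a faithful irreducible representation of the
    quotient by the kernel, and an abelian group having one is cyclic. *)
Lemma minnormal_abelian_cyclic A R :
    abelian A -> solvable R -> minnormal R A -> cyclic (A / 'C_A(R)).
Proof.
move=> abA solR minR.
have [nRA ntR /is_abelemP[p p_pr abelR]] :=
  minnormal_solvable minR (subxx R) solR.
pose rG : mx_representation 'F_p A _ := abelem_repr abelR ntR nRA.
have irrG : mx_irreducible rG by apply/abelem_mx_irrP.
rewrite -(rker_abelem abelR ntR nRA).
apply: mx_faithful_irr_abelian_cyclic (kquo_mx_faithful rG) _ _.
  exact/(quo_mx_irr (F := 'F_p)).
exact: quotient_abelian.
Qed.

End Coprime.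

(** Induction on #|A|. Let R be a minimal A-invariant subgroup of [~: Q, A] and
    B = 'C_A(R): then A / B is cyclic, so B has index p, and A = B * X with X
    of order p semiregular on R. By induction #|V : 'C_V(B)| is at least #|B|.
    If X centralised a subgroup of index at most p in W = 'C_V(B), it would act
    quadratically on W, so R would centralise W and, by the A x B lemma, V,
    against 'C_Q(V) = 1. *)
Theorem coprime_offender (gT : finGroupType) (p : nat) (V A Q : {group gT}) :
    prime p -> odd p -> p.-abelem V -> p.-abelem A ->
    abelian Q -> p^'.-group Q ->
    A \subset 'N(V) -> Q \subset 'N(V) -> A \subset 'N(Q) ->
    'C_Q(V) = 1 -> 'C_A(Q) = 1 -> A :!=: 1 ->
  #|A| < #|V : 'C_V(A)|.
Proof.
move=> p_pr odd_p abelV abelA abQ p'Q nVA nVQ nQA cQV1.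
have [pV abV _] := and3P abelV.
move: {2}_.+1 (ltnSn #|A|) => n; elim: n => // n IHn in A abelA nVA nQA *.
rewrite ltnS => leAn cAQ1 ntA.
have [pA abA _] := and3P abelA.
have coQA : coprime #|Q| #|A| by rewrite coprime_sym (pnat_coprime pA p'Q).
have ntQA : [~: Q, A] != 1.
  apply: contra ntA => /eqP/commG1P cQA.
  by rewrite -subG1 -cAQ1 subsetI subxx centsC.
have nKA : A \subset 'N([~: Q, A]) by rewrite commg_normr.
have [R minR sRK] := minnormal_exists ntQA nKA.
have sRQ : R \subset Q by rewrite (subset_trans sRK) ?commg_subl.
have abR : abelian R := abelianS sRQ abQ.
have [nRA ntR _] := minnormal_solvable minR (subxx R) (abelian_sol abR).
have cycAR := minnormal_abelian_cyclic abA (abelian_sol abR) minR.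
pose B := 'C_A(R)%G; have sBA : B \subset A := subsetIl _ _.
have cRA1 : 'C_R(A) = 1.
  apply/trivgP; rewrite -(coprime_abel_cent_TI nQA coQA abQ).
  by rewrite setSI.
have prBA : B \proper A.
  rewrite properEneq sBA andbT; apply: contraNneq ntR => /setIidPl cAR.
  by rewrite -subG1 -cRA1 subsetI subxx centsC.
have abelB := abelemS sBA abelA.
have [b Ab B'b] : exists2 b, b \in A & b \notin B by case/properP: prBA.
have ob : #[b] = p.
  by apply: (abelem_order_p abelA Ab); apply: contraNneq B'b => ->.
pose X := <[b]>%G; have sXA : X \subset A by rewrite cycle_subG.
have oX : #|X| = p by [].
have nBA : A \subset 'N(B) := sub_abelian_norm abA sBA.
have oAB : #|A : B| = p.
  rewrite -card_quotient //; apply: (cyclic_abelem_prime _ cycAR).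
    exact: quotient_abelem.
  by rewrite -subG1 quotient_sub1 // proper_subn.
have tiBX : B :&: X = 1.
  by rewrite setIC prime_TIg ?oX // cycle_subG.
have defA : B * X = A.
  apply/eqP; rewrite eqEcard mulG_subG sBA sXA TI_cardMg // oX -oAB.
  by rewrite Lagrange ?leqnn.
have regRX : semiregular R X.
  move=> x /setD1P[ntx Xx]; have Ax := subsetP sXA x Xx.
  have [_ minR'] := mingroupP minR.
  apply/eqP; apply: contraR ntx => ntC.
  have defR : 'C_R[x] = R.
    apply: minR'; rewrite ?subsetIl // ntC normsI //.
    apply: subset_trans (normG _); rewrite sub_cent1.
    exact: subsetP abA x Ax.
  rewrite -in_set1 -[[set _]]tiBX inE Xx inE Ax andbT.
  by rewrite -sub_cent1; apply/setIidPl.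
have p'R := pgroupS sRQ p'Q.
have [nVR nVX nRX nVB] :
  [/\ R \subset 'N(V), X \subset 'N(V), X \subset 'N(R) & B \subset 'N(V)].
  by split; [exact: subset_trans nVQ | exact: subset_trans nVA
            | exact: subset_trans nRA | exact: subset_trans nVA].
pose W := 'C_V(B)%G; have sWV : W \subset V := subsetIl _ _.
have cRB : B \subset 'C(R) := subsetIr _ _.
have nWR : R \subset 'N(W).
  by rewrite normsI // norms_cent // cents_norm // centsC.
have nWX : X \subset 'N(W).
  rewrite normsI // norms_cent // cents_norm // (subset_trans sXA) //.
  exact: sub_abelian_cent.
have defCW : 'C_W(X) = 'C_V(A) by rewrite -setIA -centM defA.
have ltpW : p < #|W : 'C_W(X)|.
  rewrite ltnNge; apply: contra ntR => leWp.
  rewrite -subG1 -cQV1 subsetI sRQ.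
  apply: (cent_coprime_times abV pV (pgroupS sBA pA) p'R) => //.
  have abelW := abelemS sWV abelV.
  apply: (semiregular_quadratic_cent (abelianS sWV abV) nWX p_pr) => //.
  set C := 'C_W(X)%G in leWp *; have sCW : C \subset W := subsetIl _ _.
  have nCW : W \subset 'N(C) := sub_abelian_norm (abelianS sWV abV) sCW.
  have nCX : X \subset 'N(C) by rewrite cents_norm // centsC subsetIr.
  suffices: W / C \subset 'C(X / C).
    rewrite quotient_cents2 // => sWXC; apply/commG1P.
    by rewrite (subset_trans sWXC) ?subsetIr.
  rewrite -card_quotient // in leWp.
  apply/commG1P/eqP; apply: contraT => ntWX.
  have pWX : p.-group ((W / C) <*> (X / C)).
    rewrite norm_joinEr ?quotient_norms // pgroupM.
    rewrite !quotient_pgroup ?(pgroupS sWV) //.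
    exact: pgroupS sXA pA.
  have ntW : W / C != 1 by apply: contraNneq ntWX => ->; rewrite comm1G.
  have prWX : [~: W / C, X / C] \proper (W / C).
    apply: (nil_comm_properl (pgroup_nil pWX)); rewrite ?joing_subl //.
    by rewrite subsetI joing_subr quotient_norms.
  have := leq_trans (proper_card prWX) leWp; rewrite ltnNge => /negP[].
  apply: dvdn_leq; first exact: cardG_gt0.
  have pC : p.-group [~: W / C, X / C].
    by rewrite (pgroupS (proper_sub prWX)) ?quotient_pgroup ?(pgroupS sWV).
  by have [_ ->] := pgroup_pdiv pC ntWX.
have leBV : #|B| <= #|V : W|.
  have [-> | ntB] := eqsVneq B 1; first by rewrite cards1 indexg_gt0.
  apply: ltnW; apply: IHn => //.
  - exact: subset_trans sBA nQA.
  - exact: leq_trans (proper_card prBA) leAn.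
  by apply/trivgP; rewrite -cAQ1 setSI.
have sCW : 'C_V(A) \subset W by rewrite setIS ?centS.
rewrite -(Lagrange_index sWV sCW) -(Lagrange sBA) oAB.
apply: leq_ltn_trans (leq_mul leBV (leqnn p)) _.
by rewrite ltn_pmul2l ?indexg_gt0 //; move: ltpW; rewrite defCW.
Qed.

Section Action.

Variables (gT : finGroupType) (V G : {group gT}).
Hypothesis nVG : G \subset 'N(V).
Let K := 'C_G(V)%G.

(** The action of G on V by conjugation has kernel K and so extends to a
    semidirect product of V by G / K; this places V and the quotients by K in
    one ambient group. *)
Lemma faithful_semidirect :
  exists (hT : finGroupType) (f : {morphism V >-> hT})
         (g : {morphism (G / K) >-> hT}),
    [/\ 'injm f, 'injm g
      & {in V & G, forall v x, f (v ^ x) = f v ^ g (coset K x)}].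
Proof.
have nKG : G \subset 'N(K) by rewrite normsI ?normG ?norms_cent.
pose to := (@conjg_groupAction gT %% K)%gact.
have sVR : V \subset 'C_(|'J)(K).
  by rewrite gacentJ centsC subsetIr.
have sGD : G / K \subset [set: gT] / K by rewrite quotientS ?subsetT.
pose f := restrm_morphism sVR (sdpair1_morphism to).
pose g := restrm_morphism sGD (sdpair2_morphism to).
exists (sdprod_groupType to), f, g; split.
- by rewrite injm_restrm ?injm_sdpair1.
- by rewrite injm_restrm ?injm_sdpair2.
move=> v x Vv Gx /=; rewrite /restrm.
have Nx := subsetP nKG x Gx.
rewrite -sdpair_act; last first.
- by apply: (subsetP sGD); rewrite mem_quotient.
- exact: subsetP sVR v Vv.
congr (sdpair1 _ _); rewrite /= modactE ?in_setT //.
by move: (subsetP sVR v Vv); rewrite /gacent => /setIP[].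
Qed.

(** The offender inequality for the action on V of subgroups of G taken modulo
    the kernel of that action. *)
Lemma act_offender (p : nat) (A M : {group gT}) :
    prime p -> odd p -> p.-abelem V -> p.-abelem A ->
    A \subset G -> M \subset G -> A \subset 'N(M) ->
    abelian (M / K) -> p^'.-group (M / K) -> 'C_(A / K)(M / K) = 1 ->
    ~~ (A \subset K) ->
  #|A| * #|'C_V(A)| < #|V| * #|'C_A(V)|.
Proof.
move=> p_pr odd_p abelV abelA sAG sMG nMA abMK p'MK cAM1 not_sAK.
have [hT [f [g [injf injg fJ]]]] := faithful_semidirect.
have nKG : G \subset 'N(K) by rewrite normsI ?normG ?norms_cent.
have [sAGK sMGK] : A / K \subset G / K /\ M / K \subset G / K.
  by rewrite !quotientS.
have nfV (B : {group gT}) : B \subset G -> g @* (B / K) \subset 'N(f @* V).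
  move=> sBG; apply/subsetP=> _ /morphimP[_ _ /morphimP[x _ Bx ->] ->].
  have Gx := subsetP sBG x Bx.
  rewrite inE; apply/subsetP=> _ /imsetP[_ /morphimP[v _ Vv ->] ->].
  by rewrite /= -fJ // mem_morphim // memJ_norm ?(subsetP nVG).
have cfV : f @* 'C_V(A) = 'C_(f @* V)(g @* (A / K)).
  apply/setP=> y; apply/morphimP/setIP.
    case=> v _ /setIP[Vv cAv] ->; split; first exact: mem_morphim.
    apply/centP=> _ /morphimP[_ _ /morphimP[x _ Ax ->] ->].
    apply/commgP/conjg_fixP; rewrite /= -fJ ?(subsetP sAG) //.
    by congr (f _); apply/commute_conjg/(centP cAv).
  case=> /morphimP[v _ Vv ->] cv; exists v => //; rewrite inE Vv.
  apply/centP=> x Ax; apply/commgP/conjg_fixP.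
  have Gx := subsetP sAG x Ax.
  apply: (injmP injf) => //; first by rewrite memJ_norm ?(subsetP nVG).
  rewrite fJ //; apply/commute_conjg/(centP cv).
  by rewrite mem_morphim ?mem_quotient.
have := @coprime_offender hT p (f @* V)%G (g @* (A / K))%G (g @* (M / K))%G.
rewrite -cfV (card_injm injg) // -divgS ?morphimS ?subsetIl //.
rewrite !(card_injm injf) ?subsetIl // => off.
have {off} : #|A / K| < #|V| %/ #|'C_V(A)|.
  apply: off => //.
  - exact: morphim_abelem.
  - by rewrite morphim_abelem ?quotient_abelem.
  - exact: morphim_abelian.
  - exact: morphim_pgroup.
  - exact: nfV.
  - exact: nfV.
  - by rewrite morphim_norms ?quotient_norms.
  - apply/trivgP/subsetP=> _ /setIP[/morphimP[_ _ /morphimP[x Nx Mx ->] ->] cx].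
    have Gx := subsetP sMG x Mx.
    rewrite /= coset_id ?morph1 ?inE //= Gx; apply/centP=> v Vv.
    apply: commute_sym; apply/commgP/conjg_fixP.
    apply: (injmP injf) => //; first by rewrite memJ_norm ?(subsetP nVG).
    rewrite fJ //; apply/commute_conjg/commute_sym/(centP cx).
    by rewrite mem_morphim.
  - by rewrite -injm_subcent // cAM1 morphim1.
  by rewrite morphim_injm_eq1 // -subG1 quotient_sub1 // (subset_trans sAG).
have defCA : A :&: K = 'C_A(V) by rewrite setIA (setIidPl sAG).
have -> : #|A / K| = #|A : 'C_A(V)|.
  by rewrite card_quotient ?(subset_trans sAG) // -defCA indexgI.
rewrite -[#|V| %/ _]/(#|V| %/ #|'C_V(A)%G|) divgS ?subsetIl // => lt_off.
rewrite -(Lagrange (subsetIl A 'C(V))) -(Lagrange (subsetIl V 'C(A))) /=.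
rewrite -[X in _ < X]mulnA mulnC ltn_pmul2l ?cardG_gt0 //.
by rewrite mulnC ltn_pmul2r ?cardG_gt0.
Qed.

End Action.

(** * The p-complement theorem of Thompson *)

(** The version of the Thompson subgroup built from the elementary abelian
    subgroups of maximal rank. *)
Definition ThompsonJ (gT : finGroupType) (p : nat) (P : {set gT}) :=
  <<\bigcup_(E in 'E_p^('r_p(P))(P)) E>>.

Section ThompsonJ.

Variables (gT : finGroupType) (p : nat).
Implicit Types P U A E : {group gT}.

Canonical ThompsonJ_group P := [group of ThompsonJ p P].

Lemma ThompsonJ_sub P : ThompsonJ p P \subset P.
Proof. by rewrite gen_subG; apply/bigcupsP=> E /pnElemP[]. Qed.

Lemma ThompsonJ_sup P A : A \in 'E_p^('r_p(P))(P) -> A \subset ThompsonJ p P.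
Proof. by move=> EA; rewrite sub_gen // (bigcup_sup A). Qed.

Lemma ThompsonJJ P x : ThompsonJ p (P :^ x) = ThompsonJ p P :^ x.
Proof.
rewrite /ThompsonJ -genJ p_rankJ; congr <<_>>.
apply/setP=> y; rewrite mem_conjg; apply/bigcupP/bigcupP=> [] [E EA Ey].
  exists (E :^ x^-1)%G; last by rewrite /= memJ_conjg.
  have defE : ((E :^ x^-1) :^ x)%G = E by apply/group_inj/conjsgKV.
  by rewrite -(pnElemJ x) defE.
exists (E :^ x)%G; last by rewrite /= mem_conjg.
by rewrite pnElemJ.
Qed.

Lemma ThompsonJ_norm P : 'N(P) \subset 'N(ThompsonJ p P).
Proof.
by apply/subsetP=> x /normP nPx; apply/normP; rewrite -ThompsonJJ nPx.
Qed.

Lemma ThompsonJ_neq1 P :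
  prime p -> p.-group P -> P :!=: 1 -> ThompsonJ p P != 1.
Proof.
move=> p_pr pP ntP; have [E EE] := p_rank_witness p P.
apply: contraTneq (EE) => J1; have: E \subset [1] by rewrite -J1 ThompsonJ_sup.
rewrite subG1 => /eqP E1; apply/pnElemP=> [] [_ _].
rewrite E1 cards1 logn1 => r0; have [_ pdP _] := pgroup_pdiv pP ntP.
have: 0 < 'r_p(P) by rewrite p_rank_gt0 mem_primes p_pr cardG_gt0.
by rewrite -r0.
Qed.

Lemma ThompsonJ_eq P U :
    U \subset P -> (forall A, A \in 'E_p^('r_p(P))(P) -> A \subset U) ->
  ThompsonJ p U = ThompsonJ p P.
Proof.
move=> sUP sAU; have [E EE] := p_rank_witness p P.
have r_eq : 'r_p(U) = 'r_p(P).
  apply/eqP; rewrite eqn_leq p_rankS //=; have [_ abE <-] := pnElemP EE.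
  by rewrite logn_le_p_rank //; apply/pElemP; rewrite sAU.
rewrite /ThompsonJ r_eq; congr <<_>>; apply: eq_bigl => A.
apply/pnElemP/idP=> [[sAU' abA oA] | EA].
  by apply/pnElemP; rewrite (subset_trans sAU').
by have [_ abA oA] := pnElemP EA; rewrite sAU.
Qed.

Lemma card_pnElem_max P A E : prime p ->
    A \in 'E_p^('r_p(P))(P) -> E \subset P -> p.-abelem E -> #|E| <= #|A|.
Proof.
move=> p_pr /pnElemP[sAP /andP[pA _] oA] sEP abE.
have /andP[pE _] := abE.
rewrite (card_pgroup pA) (card_pgroup pE) oA leq_exp2l ?prime_gt1 //.
by rewrite logn_le_p_rank //; apply/pElemP.
Qed.

End ThompsonJ.

Section QuotientLocal.

Variables (gT : finGroupType) (p : nat).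
Hypothesis p_pr : prime p.
Implicit Types G H P U : {group gT}.

Lemma p_local_cent_quotient G U :
    p.-group U -> U <| G -> p_local_cent p G -> p_local_cent p (G / U).
Proof.
move=> pU nsUG /(p_local_centP _ p_pr) lcG; apply/(p_local_centP _ p_pr).
move=> _ _ /(inv_quotientS nsUG)[X -> sUX sXG] pXU
  /setIP[/morphimP[x Nx Gx ->] nXx] p'x.
have pX : p.-group X.
  by rewrite -(pquotient_pgroup pU) ?(subset_trans sXG) ?normal_norm.
have nsUX : U <| X := normalS sUX sXG nsUG.
have nUy : x.`_p^' \in 'N(U) by rewrite groupX.
have def_x : coset U x = coset U x.`_p^'.
  by rewrite morph_constt //= constt_p_elt.
move: nXx p'x; rewrite /= def_x => nXx p'x.
have nXy : x.`_p^' \in 'N(X).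
  rewrite -cycle_subG -(quotientSGK _ (subset_trans sUX (normG X))).
    by rewrite quotient_normG // quotient_cycle // cycle_subG.
  by rewrite cycle_subG.
have cXy : x.`_p^' \in 'C(X).
  by apply: lcG; rewrite ?p_elt_constt // inE groupX.
rewrite -cycle_subG -quotient_cycle //; apply: quotient_cents.
by rewrite cycle_subG.
Qed.

Lemma p'group_p_local_cent G : p^'.-group G -> p_local_cent p G.
Proof.
move=> p'G; apply/(p_local_centP _ p_pr) => X y sXG pX _ _.
have -> : X :=: 1.
  by apply/card1_trivg/(pnat_1 pX); apply: pgroupS p'G.
by rewrite cent1T inE.
Qed.

End QuotientLocal.

(** The configuration reached by a minimal counterexample to the p-complement
    theorem: U is a normal p-subgroup of G; the normalisers of the larger normal
    subgroups of the Sylow subgroup P, the quotient G / U, and the proper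
    subgroups of G containing P are p-nilpotent. *)
Section ThompsonStep.

Variables (gT : finGroupType) (p : nat) (G U P : {group gT}).
Hypotheses (p_pr : prime p) (odd_p : odd p).
Hypotheses (nsUG : U <| G) (pU : p.-group U) (sylP : p.-Sylow(G) P).

Hypothesis lc_local : forall Y : {group gT},
  U \proper Y -> Y \subset P -> P \subset 'N(Y) -> p_local_cent p 'N_G(Y).
Hypothesis lc_quo : p_local_cent p (G / U).
Hypothesis lc_J : p_local_cent p 'N_G(ThompsonJ p P).
Hypothesis lc_Z : p_local_cent p 'N_G('Ohm_1('Z(P))).
Hypothesis lc_sub : forall H : {group gT},
  P \subset H -> H \proper G -> p_local_cent p H.

Let C := 'C_G(U)%G.
Let nUG : G \subset 'N(U). Proof. exact: normal_norm. Qed.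
Let sUG : U \subset G. Proof. exact: normal_sub. Qed.
Let sPG : P \subset G. Proof. exact: pHall_sub sylP. Qed.
Let pP : p.-group P. Proof. exact: pHall_pgroup sylP. Qed.
Let nCG : G \subset 'N(C). Proof. by rewrite normsI ?normG ?norms_cent. Qed.
Let sUP : U \subset P.
Proof. exact: normal_sub_max_pgroup (Hall_max sylP) pU nsUG. Qed.

(** A p'-element y normalising a p-subgroup X acts trivially on X / U because
    G / U is p-nilpotent, and on U by hypothesis; a coprime action that is
    trivial on both layers is trivial. *)
Lemma lc_of_cent_quotient : p.-group (G / C) -> p_local_cent p G.
Proof.
move=> pGC; apply/(p_local_centP _ p_pr) => X y sXG pX /setIP[Gy nXy] p'y.
have /setIP[_ cUy] := pgroup_quotient_mem nCG pGC Gy p'y.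
have nUX := subset_trans sXG nUG; have nUy := subsetP nUG y Gy.
have cXUy : coset U y \in 'C(X / U).
  move/(p_local_centP _ p_pr): lc_quo; apply.
  - exact: quotientS.
  - exact: quotient_pgroup.
  - rewrite inE mem_quotient //=; apply: (subsetP (quotient_norms _ (subxx _))).
    exact: mem_quotient.
  exact: morph_p_elt.
rewrite -sub_cent1 -cent_cycle.
apply: coprime_comm_cent.
- by rewrite cycle_subG.
- exact: pnat_coprime pX p'y.
- exact: pgroup_sol pX.
rewrite centsC cycle_subG; apply: (subsetP (centS _)) cUy.
rewrite -quotient_cents2 ?cycle_subG // quotient_cycle //.
by rewrite centsC cycle_subG.
Qed.

(** Frattini argument: E and the normaliser of P :&: E generate G, and if
    P :&: E is larger than U that normaliser is p-nilpotent, so its p'-elements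
    centralise U and lie in E. *)
Lemma quotient_of_bigger_core (E : {group gT}) :
    E <| G -> U \subset E -> C \subset E -> P :&: E != U ->
  p.-group (G / E).
Proof.
move=> nsEG sUE sCE neqU.
pose R := (E :&: P)%G; have sylR : p.-Sylow(E) R := Sylow_setI_normal nsEG sylP.
have nRP : P \subset 'N(R).
  by rewrite normsI ?normG // (subset_trans sPG) // normal_norm.
have sRP : R \subset P := subsetIr _ _.
have ltUR : U \proper R.
  by rewrite properEneq /= setIC eq_sym neqU subsetI sUE sUP.
have lcN := lc_local ltUR sRP nRP.
have nEN : 'N_G(R) \subset 'N(E).
  by rewrite (subset_trans (subsetIl _ _)) ?normal_norm.
rewrite -(Frattini_arg nsEG sylR) quotientMidl.
apply: pgroup_quotient_gen => // y Ny p'y; have /setIP[Gy nRy] := Ny.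
apply: (subsetP sCE); rewrite inE Gy.
apply: (subsetP (centS (proper_sub ltUR))).
move/(p_local_centP _ p_pr): lcN; apply=> //.
- by rewrite subsetI normG (subset_trans sRP).
- exact: pgroupS pP.
by rewrite inE Ny.
Qed.

Section NotLocal.

Hypothesis nlcG : ~~ p_local_cent p G.

Lemma centraliser_index_not_pgroup (E : {group gT}) :
    E <| G -> C \subset E -> p.-group (E / C) -> ~~ p.-group (G / E).
Proof.
move=> nsEG sCE pEC; apply: contra nlcG => pGE; apply: lc_of_cent_quotient.
apply: pgroup_quotient_gen => // y Gy p'y.
have Ey := pgroup_quotient_mem (normal_norm nsEG) pGE Gy p'y.
apply: pgroup_quotient_mem pEC Ey p'y.
by rewrite (subset_trans (normal_sub nsEG)).
Qed.

(** Otherwise the normal subgroup U * C has a Sylow subgroup larger than U. *)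
Lemma Sylow_cent_sub : 'C_P(U) \subset U.
Proof.
pose E := (U <*> C)%G.
have nsEG : E <| G.
  by rewrite /normal join_subG sUG subsetIl /= normsY.
have sCE : C \subset E := joing_subr _ _.
have pEC : p.-group (E / C).
  rewrite /= norm_joinEl ?(subset_trans sUG) // quotientMidr.
  exact: quotient_pgroup.
have := centraliser_index_not_pgroup nsEG sCE pEC.
apply: contraR => notsub; apply: quotient_of_bigger_core => //.
  exact: joing_subl.
apply: contraNneq notsub => defU; rewrite -{2}defU.
by rewrite subsetI subsetIl (subset_trans (setSI _ sPG)).
Qed.

(** Modulo U, the group G is a p'-group N extended by P. Choose a prime
    q != p dividing #|G / C| and a P-invariant Sylow q-subgroup Q of N. If Q and
    P did not generate G / U, the preimage of Q * (P / U) would be p-nilpotent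
    and a Sylow q-subgroup of G would centralise U, against the choice of q. So
    G = M * P with M / U = Q; and as the preimage of Q^`(1) * (P / U) is a
    proper subgroup, hence p-nilpotent, the p'-elements of M^`(1) centralise U,
    while its p-elements lie in U. *)
Lemma solvable_layer : exists M : {group gT},
  [/\ U \subset M, M <| G, M * P = G, p^'.-group (M / U)
    & M^`(1) \subset U * C].
Proof.
have nUP := subset_trans sPG nUG.
have nC : ~~ p.-group (G / C) by apply: contra nlcG; apply: lc_of_cent_quotient.
have [q [q_pr neq_qp qGC]] := not_pgroup_prime_dvd nC.
pose N := pprime_gen_group p (G / U).
have p'N : p^'.-group N := Frobenius_pprime_gen lc_quo.
have [sNG nNG] := andP (pprime_gen_normal p (G / U)).
have pGN : p.-group ((G / U) / N) := pprime_gen_quotient _ p_pr.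
have sylPU : p.-Sylow(G / U) (P / U) := quotient_pHall nUP sylP.
have pPU : p.-group (P / U) := pHall_pgroup sylPU.
have sPUG : P / U \subset G / U := pHall_sub sylPU.
have nNP := subset_trans sPUG nNG.
have defGU : N * (P / U) = G / U.
  apply/eqP; rewrite eqEsubset mulG_subG sNG sPUG /= -quotientSK //.
  by rewrite (pHall_id (quotient_pHall nNP sylPU) pGN).
have coNP : coprime #|N| #|P / U| by rewrite coprime_sym (pnat_coprime pPU).
have [Q sylQ nQP] := sol_coprime_Sylow_exists q (pgroup_sol pPU) nNP coNP.
have [sQN qQ q'NQ] := and3P sylQ; have sQG := subset_trans sQN sNG.
have p'Q := pgroupS sQN p'N.
have coQP : coprime #|Q| #|P / U| := coprimeSg sQN coNP.
have lcover (R : {group coset_of U}) : R \subset Q -> P / U \subset 'N(R) ->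
    R * (P / U) != G / U ->
  exists2 L : {group gT}, L / U = R * (P / U)
    & [/\ U \subset L, L \subset G & p_local_cent p L].
- move=> sRQ nRP neqG.
  have sRPG : R <*> (P / U) \subset G / U.
    by rewrite join_subG sPUG (subset_trans sRQ).
  have [L defL sUL sLG] := inv_quotientS nsUG sRPG.
  have {}defL : L / U = R * (P / U) by rewrite -defL /= norm_joinEr.
  exists L => //; split=> //; apply: lc_sub.
    by rewrite -(quotientSGK nUP sUL) defL mulG_subr.
  rewrite properEneq sLG andbT; apply: contraNneq neqG => <-.
  by rewrite defL.
have defQP : Q * (P / U) = G / U.
  apply/eqP; apply: contraT => /(lcover _ (subxx _) nQP)[L defL [sUL sLG lcL]].
  have [T sylT] := Sylow_exists q L; have [sTL qT q'LT] := and3P sylT.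
  have sTC : T \subset C.
    apply/subsetP=> t Tt; have Lt := subsetP sTL t Tt.
    rewrite inE (subsetP sLG) //=.
    move/(p_local_centP _ p_pr): lcL; apply=> //.
      by rewrite inE Lt (subsetP nUG) ?(subsetP sLG).
    by apply: sub_p_elt (mem_p_elt qT Tt) => r; rewrite inE => /eqnP->.
  have oGU : #|G / U| = (#|N| * #|P / U|)%N.
    by rewrite -coprime_cardMg // defGU.
  have oGL : #|G : L| = #|N : Q|.
    rewrite -(index_quotient_eq _ sLG nUG); last by rewrite subIset ?sUL ?orbT.
    rewrite -(divgS (quotientS U sLG)) /= oGU defL coprime_cardMg //.
    by rewrite divnMr ?cardG_gt0 // divgS.
  have q'GT : q^'.-nat #|G : T|.
    by rewrite -(Lagrange_index sLG sTL) pnatM oGL q'NQ.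
  have := pnat_dvd (indexgS G sTC) q'GT.
  by rewrite -card_quotient // p'natE // qGC.
have ntQ : Q :!=: 1.
  apply: contraNneq nC => Q1; rewrite quotient_pgroup //.
  by rewrite -(pquotient_pgroup pU nUG) -defQP Q1 mul1g.
have [M defM sUM sMG] := inv_quotientS nsUG sQG.
have nMG : G \subset 'N(M).
  have nsUM := normalS sUM sMG nsUG.
  rewrite -(quotientSGK nUG (subset_trans sUM (normG M))) quotient_normG //.
  by rewrite -defM -defQP mulG_subG normG.
have solQ := pgroup_sol qQ.
have prQ' := sol_der1_proper solQ (subxx _) ntQ.
have [|||L1 defL1 [sUL1 sL1G lcL1]] := lcover Q^`(1)%G.
- exact: der_sub.
- exact: char_norm_trans (der_char 1 Q) nQP.
- apply: contraTneq (proper_card prQ') => defG; rewrite -leqNgt.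
  rewrite -(leq_pmul2r (cardG_gt0 (P / U))) -!coprime_cardMg //.
    by rewrite defQP -defG.
  exact: coprimeSg (der_sub 1 Q) coQP.
exists M; split=> //.
- by rewrite /normal sMG.
- rewrite -norm_joinEr ?(subset_trans sPG) //; apply/eqP.
  rewrite eqEsubset join_subG sMG sPG /=.
  rewrite -(quotientSGK nUG) ?(subset_trans sUM) ?joing_subl //.
  by rewrite quotientY ?(subset_trans sMG) // -defM norm_joinEr ?defQP.
- by rewrite -defM.
apply/subsetP=> x M'x; have Mx := subsetP (der_sub 1 M) x M'x.
have nUM := subset_trans sMG nUG; have nUx := subsetP nUM x Mx.
have L1x : x \in L1.
  rewrite -cycle_subG -(quotientSGK _ sUL1) ?cycle_subG // defL1.
  rewrite quotient_cycle //; apply: subset_trans (mulG_subl _ _).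
  rewrite cycle_subG; change (coset U x \in Q^`(1)).
  rewrite defM -quotient_der //.
  exact: mem_quotient.
rewrite -(consttC p x) mem_mulg //.
  have nUxp : x.`_p \in 'N(U) by rewrite groupX.
  apply: coset_idr => //; apply/eqP; rewrite -order_eq1; apply/eqP.
  apply: (@pnat_1 p); first by rewrite -/(p_elt _ _) morph_p_elt ?p_elt_constt.
  apply: mem_p_elt p'Q _; rewrite defM mem_quotient //; exact: groupX.
rewrite inE groupX ?(subsetP sMG) //=.
move/(p_local_centP _ p_pr): lcL1; apply=> //; last exact: p_elt_constt.
by rewrite inE !groupX ?(subsetP nUM).
Qed.

Let V := 'Ohm_1('Z(U))%G.
Let K := 'C_G(V)%G.

Let sVZ : V \subset 'Z(U). Proof. exact: Ohm_sub. Qed.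
Let sVU : V \subset U. Proof. exact: subset_trans sVZ (center_sub U). Qed.
Let nVG : G \subset 'N(V).
Proof.
exact: char_norm_trans (char_trans (Ohm_char 1 _) (center_char U)) nUG.
Qed.
Let nKG : G \subset 'N(K). Proof. by rewrite normsI ?normG ?norms_cent. Qed.
Let nsKG : K <| G. Proof. by rewrite /normal subsetIl. Qed.
Let sCK : C \subset K. Proof. by rewrite setIS ?centS. Qed.
Let sUK : U \subset K.
Proof.
by rewrite subsetI sUG centsC (subset_trans sVZ) // subsetIr.
Qed.

(** If G / K were a p-group then G = K * P would normalise the socle of 'Z(P),
    which is contained in V. *)
Lemma socle_index_not_pgroup : ~~ p.-group (G / K).
Proof.
apply: contra nlcG => pGK; suffices nZG : G \subset 'N('Ohm_1('Z(P))).
  by have := lc_Z; rewrite (setIidPl nZG).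
have sZV : 'Ohm_1('Z(P)) \subset V.
  apply: OhmS; rewrite subsetI; have cZP : 'Z(P) \subset 'C(U).
    by rewrite subIset // (centS sUP) orbT.
  by rewrite cZP (subset_trans _ Sylow_cent_sub) // subsetI cZP center_sub.
have nKP := subset_trans sPG nKG.
have defG : K * P = G.
  apply/eqP; rewrite eqEsubset mulG_subG subsetIl sPG /= -quotientSK //.
  by rewrite (pHall_id (quotient_pHall nKP sylP) pGK).
rewrite -defG mulG_subG; apply/andP; split.
  by rewrite (subset_trans _ (cent_sub _)) // subIset // (centS sZV) orbT.
by rewrite (char_norm_trans (char_trans (Ohm_char 1 _) (center_char P))) ?normG.
Qed.

Lemma Sylow_socle_cent : P :&: K = U.
Proof.
apply/eqP; apply: contraR socle_index_not_pgroup.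
exact: quotient_of_bigger_core.
Qed.

(** The preimage E of this p-core has P :&: E = U by quotient_of_bigger_core,
    and the Sylow subgroup P :&: E covers E / K. *)
Lemma pcore_quotient_trivial : 'O_p(G / K) = 1.
Proof.
have [E defE sKE nsEG] := inv_quotientN nsKG (pcore_normal p (G / K)).
have sUE := subset_trans sUK sKE.
have pEK : p.-group (E / K) by rewrite -defE pcore_pgroup.
have PE : P :&: E = U.
  apply/eqP; apply: contraR socle_index_not_pgroup => neqU.
  have pGE := quotient_of_bigger_core nsEG sUE (subset_trans sCK sKE) neqU.
  apply: pgroup_quotient_gen => // y Gy p'y.
  have Ey := pgroup_quotient_mem (normal_norm nsEG) pGE Gy p'y.
  apply: pgroup_quotient_mem pEK Ey p'y.
  exact: subset_trans (normal_sub nsEG) nKG.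
have sylU : p.-Sylow(E) U.
  by have := Sylow_setI_normal nsEG sylP; rewrite setIC PE.
rewrite defE -(pHall_id (quotient_pHall (subset_trans sUG nKG) sylU) pEK).
exact: quotientS1.
Qed.

(** Otherwise the Thompson subgroup of P is that of U, hence is normal in G. *)
Lemma offending_elem_abelian : exists2 A : {group gT},
  A \in 'E_p^('r_p(P))(P) & ~~ (A \subset K).
Proof.
have [/exists_inP //|] :=
  boolP [exists A in 'E_p^('r_p(P))(P), ~~ (A \subset K)].
rewrite negb_exists_in => /forall_inP sAK; case/negP: nlcG.
suffices nJG : G \subset 'N(ThompsonJ p P).
  by have := lc_J; rewrite (setIidPl nJG).
rewrite -(ThompsonJ_eq sUP).
  exact: subset_trans nUG (ThompsonJ_norm p U).
move=> A EA; rewrite -Sylow_socle_cent subsetI; have [-> _ _] := pnElemP EA.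
by have := sAK A EA; rewrite negbK.
Qed.

(** An elementary abelian A of maximal rank in P not contained in K acts
    nontrivially on V. The product of V and 'C_A(V) is an elementary abelian
    subgroup of P, so its order is at most #|A|; this contradicts act_offender
    applied to the abelian p'-group M / K, on which A / K acts faithfully
    because 'O_p(G / K) = 1. *)
Lemma minimal_configuration_false : False.
Proof.
have [M [sUM nsMG defG p'MU sM'UC]] := solvable_layer.
have [sMG nMG] := andP nsMG; have nKM := subset_trans sMG nKG.
have nKP := subset_trans sPG nKG.
have [A EA not_sAK] := offending_elem_abelian.
have [sAP abelA _] := pnElemP EA; have sAG := subset_trans sAP sPG.
have [pA abA _] := and3P abelA.
have abelV : p.-abelem V.
  by rewrite Ohm1_abelem ?center_abelian // (pgroupS (center_sub U)).
have abMK : abelian (M / K).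
  apply: sub_der1_abelian; apply: subset_trans sM'UC _.
  by rewrite mulG_subG sUK.
have p'MK : p^'.-group (M / K).
  have nUM := subset_trans sMG nUG.
  rewrite /pgroup card_quotient //; apply: pnat_dvd (indexgS M sUK) _.
  by rewrite -card_quotient.
have defGK : (M / K) * (P / K) = G / K by rewrite -quotientMl // defG.
have cPM1 : 'C_(P / K)(M / K) = 1.
  apply/trivgP; rewrite -pcore_quotient_trivial; apply: pcore_max.
    by rewrite (pgroupS (subsetIl _ _)) ?quotient_pgroup.
  rewrite /normal subIset ?quotientS //=.
  rewrite -defGK mulG_subG; apply/andP; split.
    by rewrite (subset_trans _ (cent_sub _)) // centsC subsetIr.
  rewrite normsI ?normG // norms_cent // quotient_norms //.
  exact: subset_trans sPG nMG.
have cAM1 : 'C_(A / K)(M / K) = 1.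
  by apply/trivgP; rewrite -cPM1 setSI ?quotientS.
have nMA := subset_trans sAG nMG.
have := act_offender nVG p_pr odd_p abelV abelA sAG sMG nMA abMK p'MK cAM1
  not_sAK.
rewrite ltnNge => /negP[].
pose B := 'C_A(V)%G; have sVP := subset_trans sVU sUP.
have cVB : B \subset 'C(V) := subsetIr _ _.
have abelVB : p.-abelem (V <*> B).
  have defVB : V \* B = V <*> B by rewrite cprodEY // centsC.
  by rewrite (cprod_abelem _ defVB) abelV (abelemS (subsetIl _ _) abelA).
have leVB : #|V <*> B| <= #|A|.
  apply: card_pnElem_max EA _ abelVB => //.
  by rewrite join_subG sVP (subset_trans (subsetIl _ _)).
rewrite mul_cardG -cent_joinEr //; apply: leq_mul leVB _.
apply: subset_leq_card; rewrite subsetI subsetIl /=.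
by rewrite (subset_trans _ abA) // (subset_trans (subsetIr _ _)) ?subsetIl.
Qed.

End NotLocal.

Theorem Thompson_step : p_local_cent p G.
Proof. by apply: contraT => /minimal_configuration_false. Qed.

End ThompsonStep.

Lemma Ohm1_center_neq1 (gT : finGroupType) (p : nat) (P : {group gT}) :
  p.-group P -> P :!=: 1 -> 'Ohm_1('Z(P)) != 1.
Proof.
by move=> pP ntP; rewrite Ohm1_eq1 (center_nil_eq1 (pgroup_nil pP)).
Qed.

(** In a minimal counterexample, choose a nontrivial p-subgroup U whose
    normaliser is not p-nilpotent, so that first #|'N_G(U)| `_p and then #|U|
    are as large as possible. If a Sylow p-subgroup S of N = 'N_G(U) is not
    Sylow in G, then characteristic subgroups of S have normalisers with larger
    p-part; so N inherits the hypotheses, and N = G. Hence U is normal, and the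
    choice of U together with minimality yields the hypotheses of
    Thompson_step. *)
Theorem Thompson_p_complement (p : nat) : prime p -> odd p ->
  forall (gT : finGroupType) (G : {group gT}),
    (forall P : {group gT}, p.-Sylow(G) P ->
       p_local_cent p 'N_G(ThompsonJ p P) /\
      p_local_cent p 'N_G('Ohm_1('Z(P)))) ->
  p_local_cent p G.
Proof.
move=> p_pr odd_p gT G; move: {2}_.+1 (ltnSn #|G|) => n.
elim: n => // n IHn in gT G *; rewrite ltnS => leGn lcJZ.
apply: contraT => nlcG.
pose bad (X : {group gT}) :=
  [&& X \subset G, p.-group X, X :!=: 1 & ~~ p_local_cent p 'N_G(X)].
have [X badX] : exists X, bad X.
  have [X /andP[sXG pX] notpX] := forall_inPn nlcG.
  exists X; rewrite /bad sXG pX /=; apply/andP; split.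
    apply: contraNneq notpX => ->; rewrite cent1T norm1 !setIT.
    by rewrite trivg_quotient pgroup1.
  apply: contra notpX => /forall_inP/(_ X).
  rewrite -!setIA setIid (setIidPr (cent_sub X)); apply.
  by rewrite subsetI sXG normG.
(* mu orders pairs lexicographically, since #|Y| < #|G|.+1. *)
pose mu (Y : {group gT}) := (#|'N_G(Y)| `_p * #|G|.+1 + #|Y|)%N.
case: (arg_maxnP mu badX) => U /and4P[sUG pU ntU nlcU] maxU.
have lc_gt (Y : {group gT}) : Y \subset G -> p.-group Y -> Y :!=: 1 ->
    mu U < mu Y -> p_local_cent p 'N_G(Y).
  move=> sYG pY ntY; apply: contraLR => nlcY; rewrite -leqNgt.
  by apply: maxU; rewrite /bad sYG pY ntY.
have mu_gt (Y : {group gT}) : #|'N_G(U)| `_p < #|'N_G(Y)| `_p -> mu U < mu Y.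
  move=> ltUY; apply: leq_trans (leq_addr _ _).
  apply: leq_trans (leq_mul ltUY (leqnn _)); rewrite /mu mulSn addnC ltn_add2r.
  by rewrite ltnS subset_leq_card.
have nUN : U <| 'N_G(U) by rewrite normalSG.
have defG : 'N_G(U) = G.
  apply/eqP; apply: contraNT nlcU => neqG.
  have prNG : 'N_G(U) \proper G by rewrite properEneq neqG subsetIl.
  apply: IHn => [|S sylS]; first exact: leq_trans (proper_card prNG) leGn.
  have [sSN pS _] := and3P sylS.
  have sSG := subset_trans sSN (subsetIl _ _).
  have ntS : S :!=: 1.
    exact: subG1_contra (normal_sub_max_pgroup (Hall_max sylS) pU nUN) ntU.
  have [P sylP sSP] := Sylow_superset sSG pS.
  have [sPG pP _] := and3P sylP.
  have loc (F : {group gT}) : F \subset S -> F :!=: 1 -> 'N(S) \subset 'N(F) ->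
      (S :=: P -> p_local_cent p 'N_G(F)) -> p_local_cent p 'N_('N_G(U))(F).
    move=> sFS ntF nFS lcP.
    apply: (p_local_centS p_pr (setSI _ (subsetIl G 'N(U)))).
    have [/eqP/lcP // | neqSP] := boolP (S :==: P).
    have prSP : S \proper P by rewrite properEneq neqSP.
    apply: lc_gt => //; [exact: subset_trans sSG | exact: pgroupS pS |].
    apply: mu_gt; rewrite -(card_Hall sylS).
    have prSN := nilpotent_proper_norm (pgroup_nil pP) prSP.
    apply: leq_trans (proper_card prSN) _.
    rewrite -(part_pnat_id (pgroupS (subsetIl P 'N(S)) pP)).
    rewrite dvdn_leq ?part_gt0 // partn_dvd ?cardG_gt0 // cardSg //.
    exact: setISS.
  have [lcJ lcZ] := lcJZ P sylP.
  split; apply: loc.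
  - exact: ThompsonJ_sub.
  - exact: ThompsonJ_neq1.
  - exact: ThompsonJ_norm.
  - by move/group_inj->.
  - exact: subset_trans (Ohm_sub 1 _) (center_sub S).
  - exact: Ohm1_center_neq1 pS ntS.
  - by rewrite char_norms // (char_trans (Ohm_char 1 _)) ?center_char.
  by move/group_inj->.
have nsUG : U <| G by rewrite -defG.
have [P sylP] := Sylow_exists p G; have [sPG pP _] := and3P sylP.
have [lcJ lcZ] := lcJZ P sylP.
have lc_local (Y Q : {group gT}) :
    p.-Sylow(G) Q -> U \proper Y -> Y \subset Q ->
    Q \subset 'N(Y) -> p_local_cent p 'N_G(Y).
  move=> sylQ prUY sYQ nYQ; have [sQG pQ _] := and3P sylQ.
  apply: lc_gt.
  - exact: subset_trans sQG.
  - exact: pgroupS pQ.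
  - by apply: contraTneq prUY => ->; rewrite properE sub1G andbF.
  rewrite /mu -addnS leq_add ?proper_card // leq_mul2r /= defG.
  rewrite -(card_Hall sylQ) -(part_pnat_id pQ).
  rewrite dvdn_leq ?part_gt0 // partn_dvd ?cardG_gt0 // cardSg //.
  by rewrite subsetI sQG.
case/negP: nlcG; apply: (Thompson_step p_pr odd_p nsUG pU sylP) => //.
- by move=> Y; apply: lc_local.
- apply: IHn => [|Qb sylQb].
    by apply: leq_trans leGn; rewrite ltn_quotient.
  have [Q defQ sUQ sQG] := inv_quotientS nsUG (pHall_sub sylQb).
  have nsUQ := normalS sUQ sQG nsUG.
  have sylQ : p.-Sylow(G) Q by rewrite -(pquotient_pHall pU nsUG nsUQ) // -defQ.
  have [Qb1 | ntQb] := eqsVneq Qb 1.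
    have p'GU : p^'.-group (G / U).
      by rewrite /pgroup -partn_eq1 ?cardG_gt0 // -(card_Hall sylQb) Qb1 cards1.
    split; apply: (p'group_p_local_cent p_pr);
      exact: pgroupS (subsetIl _ _) p'GU.
  have loc (F : {group coset_of U}) :
      F \subset Qb -> F :!=: 1 -> Qb \subset 'N(F) ->
      p_local_cent p 'N_(G / U)(F).
    move=> sFQ ntF nFQ.
    have sFQU : F \subset Q / U by rewrite -defQ.
    have [Y defF sUY sYQ] := inv_quotientS nsUQ sFQU.
    have sYG := subset_trans sYQ sQG; have nsUY := normalS sUY sYG nsUG.
    have nUQ := subset_trans sQG (normal_norm nsUG).
    rewrite defF -quotient_subnormG //.
    apply: (p_local_cent_quotient p_pr pU).
      apply: normalS nsUG; last exact: subsetIl.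
      by rewrite subsetI sUG (subset_trans sUY) ?normG.
    apply: (lc_local _ _ sylQ) => //.
      rewrite properEneq sUY andbT; apply: contraNneq ntF => defU.
      by rewrite defF -defU trivg_quotient.
    rewrite -(quotientSGK nUQ (subset_trans sUY (normG Y))) quotient_normG //.
    by rewrite -defF -defQ.
  have nQb := pgroup_nil (pHall_pgroup sylQb); have pQb := pHall_pgroup sylQb.
  split; apply: loc.
  - exact: ThompsonJ_sub.
  - exact: ThompsonJ_neq1.
  - exact: subset_trans (normG _) (ThompsonJ_norm p Qb).
  - exact: subset_trans (Ohm_sub 1 _) (center_sub _).
  - exact: Ohm1_center_neq1 pQb ntQb.
  exact: char_norm_trans (char_trans (Ohm_char 1 _) (center_char _)) (normG _).
move=> L sPL prLG; apply: IHn => [|S sylS].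
  exact: leq_trans (proper_card prLG) leGn.
have sLG := proper_sub prLG.
have sylSG : p.-Sylow(G) S.
  rewrite pHallE (subset_trans (pHall_sub sylS)) //= (card_Hall sylS).
  by rewrite -(card_Hall sylP) (card_Hall (pHall_subl sPL sLG sylP)).
have [lcJS lcZS] := lcJZ S sylSG.
by split; [apply: p_local_centS lcJS | apply: p_local_centS lcZS];
  rewrite ?setSI.
Qed.

(** * Nilpotency of Frobenius kernels *)

Lemma prime_semiregular (gT : finGroupType) (K X : {group gT}) :
  prime #|X| -> 'C_K(X) = 1 -> semiregular K X.
Proof.
move=> pr_X cKX1 x /setD1P[ntx Xx]; rewrite -cKX1 -cent_cycle.
have sxX : <[x]> \subset X by rewrite cycle_subG.
congr (_ :&: 'C(_)); apply/eqP; rewrite eqEsubset sxX.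
apply: contraR ntx => /(prime_TIg pr_X) tiX.
by rewrite -cycle_eq1 -subG1 -tiX subsetI sxX subxx.
Qed.

Lemma pgroup_quotient_Sylow (gT : finGroupType) (p : nat) (K C : {group gT}) :
    C <| K ->
    (forall q, prime q -> q != p -> exists2 Q : {group gT},
       q.-Sylow(K) Q & Q \subset C) ->
  p.-group (K / C).
Proof.
move=> /andP[_ nCK] sylC; apply/pgroupP=> q q_pr qKC.
apply: contraLR qKC => neq_qp.
have [|Q /and3P[_ _ q'KQ] sQC] := sylC q q_pr; first by rewrite inE in neq_qp.
rewrite -p'natE // card_quotient //; exact: pnat_dvd (indexgS K sQC) q'KQ.
Qed.

(** By the trace argument every X-invariant Sylow q-subgroup of K with q != p
    centralises V, so K acts on V as a p-group and has nontrivial fixed points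
    there. *)
Lemma center_of_normal_abelian (gT : finGroupType) (p : nat)
    (K X V : {group gT}) :
    solvable X -> X :!=: 1 -> X \subset 'N(K) -> coprime #|K| #|X| ->
    semiregular K X -> p.-group V -> abelian V -> V :!=: 1 -> V <| K ->
    X \subset 'N(V) ->
  'Z(K) != 1.
Proof.
move=> solX ntX nKX coKX regKX pV abV ntV /andP[sVK nVK] nVX.
have cVX1 : 'C_V(X) = 1.
  have [x Xx ntx] := trivgPn _ ntX; apply/trivgP.
  rewrite -(regKX x) ?inE ?ntx //; apply: setISS => //.
  by rewrite -cent_set1 centS ?sub1set.
pose C := 'C_K(V)%G.
have nsCK : C <| K by rewrite /normal subsetIl normsI ?normG ?norms_cent.
have pKC : p.-group (K / C).
  apply: pgroup_quotient_Sylow => // q q_pr neq_qp.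
  have [Q sylQ nQX] := sol_coprime_Sylow_exists q solX nKX coKX.
  have [sQK qQ _] := and3P sylQ; exists Q => //; rewrite subsetI sQK.
  apply: (semiregular_TI_cent abV nVX) => //.
  - exact: subset_trans nVK.
  - apply: pnat_coprime pV _; apply: sub_pgroup qQ => r /eqnP->.
    by rewrite !inE.
  - exact: semiregularS sQK (subxx _) regKX.
have [P sylP] := Sylow_exists p K; have [sPK pP _] := and3P sylP.
have sVP : V \subset P.
  by rewrite (normal_sub_max_pgroup (Hall_max sylP)) // /normal sVK.
have nsVP : V <| P by rewrite /normal sVP (subset_trans sPK).
apply: subG1_contra (meet_center_nil (pgroup_nil pP) nsVP ntV).
rewrite subsetI subIset ?sVK //=.
have nCP := subset_trans sPK (normal_norm nsCK).
have defK : C * P = K.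
  apply/eqP; rewrite eqEsubset mulG_subG subsetIl sPK /=.
  rewrite -quotientSK ?normal_norm //.
  by rewrite (pHall_id (quotient_pHall nCP sylP) pKC).
rewrite -defK centM subsetI; apply/andP; split.
  by rewrite centsC (subset_trans (subsetIr _ _)) // centS ?subsetIl.
by rewrite (subset_trans (subsetIr _ _)) // subsetIr.
Qed.

(** In a minimal counterexample 'Z(K) = 1, for otherwise the quotient by the
    centre is nilpotent. So by center_of_normal_abelian, no nontrivial
    X-invariant normal subgroup of K is a q-group, for any q. *)
Theorem Thompson_kernel_nilpotent (gT : finGroupType) (K X : {group gT}) :
    X \subset 'N(K) -> prime #|X| -> coprime #|K| #|X| -> 'C_K(X) = 1 ->
  nilpotent K.
Proof.
move: {2}_.+1 (ltnSn #|K|) => n; elim: n => // n IHn in gT K X *.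
rewrite ltnS => leKn nKX pr_X coKX cKX1.
have [-> | ntK] := eqsVneq K 1; first exact: nilpotent1.
have regKX := prime_semiregular pr_X cKX1.
have solX : solvable X := abelian_sol (cyclic_abelian (prime_cyclic pr_X)).
have ntX : X :!=: 1 by rewrite -cardG_gt1 prime_gt1.
have sub_nil (L : {group gT}) : L \proper K -> X \subset 'N(L) -> nilpotent L.
  move=> prLK nLX; have sLK := proper_sub prLK.
  apply: (IHn gT L X) => //.
  - exact: leq_trans (proper_card prLK) leKn.
  - exact: coprimeSg coKX.
  by apply/trivgP; rewrite -cKX1 setSI.
have [Z1 | ntZ] := eqsVneq 'Z(K) 1; last first.
  rewrite -quotient_center_nil.
  have nZX : X \subset 'N('Z(K)) := char_norm_trans (center_char K) nKX.
  have tiXZ : X :&: 'Z(K) = 1.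
    by rewrite setIC coprime_TIg // (coprimeSg (center_sub K)).
  apply: (IHn _ (K / 'Z(K))%G (X / 'Z(K))%G).
  - by apply: leq_trans leKn; rewrite ltn_quotient ?center_sub.
  - exact: quotient_norms.
  - by rewrite /= -(card_isog (quotient_isog nZX _)) // setIC.
  - exact: coprime_morph.
  rewrite /= -strongest_coprime_quotient_cent ?cKX1 ?quotient1 ?solX ?orbT //.
    by rewrite subIset ?center_sub.
  by rewrite (coprimeSg _ coKX) // subIset ?center_sub.
have no_normal (q : nat) (W : {group gT}) :
    q.-group W -> W <| K -> X \subset 'N(W) -> W :=: 1.
  move=> qW nsWK nWX; apply/eqP; apply: contraT => ntW.
  have ntZW : 'Z(W) != 1 by rewrite (center_nil_eq1 (pgroup_nil qW)).
  have qZW := pgroupS (center_sub W) qW.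
  have nsZK := char_normal_trans (center_char W) nsWK.
  have nZX := char_norm_trans (center_char W) nWX.
  by have /eqP[] := center_of_normal_abelian solX ntX nKX coKX regKX
       qZW (center_abelian W) ntZW nsZK nZX.
have local (q : nat) (W : {group gT}) :
    q.-group W -> W \subset K -> W :!=: 1 -> X \subset 'N(W) ->
  nilpotent 'N_K(W).
  move=> qW sWK ntW nWX; apply: sub_nil; last first.
    by rewrite normsI // norms_norm.
  rewrite properEneq subsetIl andbT; apply: contraNneq ntW => /setIidPl nWK.
  by rewrite (no_normal q W) // /normal sWK.
have [p p_pr [odd_p pK]] : exists2 p, prime p & odd p /\ p %| #|K|.
  have [q [q_pr /negPf q_neq2 qK]] :
      exists q, [/\ prime q, q != 2 & q %| #|K|].
    apply: not_pgroup_prime_dvd; apply: contra_eqN Z1 => /pgroup_nil nilK.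
    by rewrite (center_nil_eq1 nilK).
  exists q => //; split=> //.
  by have [/eqP|] := even_prime q_pr; rewrite ?q_neq2.
have [P sylP nPX] := sol_coprime_Sylow_exists p solX nKX coKX.
have [sPK pP _] := and3P sylP.
have ntP : P :!=: 1.
  apply: contraTneq pK => P1; rewrite -p'natE // -partn_eq1 //.
  by rewrite -(card_Hall sylP) P1 cards1.
have lcJ : p_local_cent p 'N_K(ThompsonJ p P).
  apply: nilpotent_p_local_cent => //; apply: (local p).
  - exact: pgroupS (ThompsonJ_sub p P) pP.
  - exact: subset_trans (ThompsonJ_sub p P) sPK.
  - exact: ThompsonJ_neq1.
  - exact: subset_trans nPX (ThompsonJ_norm p P).
have sZP : 'Ohm_1('Z(P)) \subset P := subset_trans (Ohm_sub 1 _) (center_sub P).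
have lcZ : p_local_cent p 'N_K('Ohm_1('Z(P))).
  apply: nilpotent_p_local_cent => //; apply: (local p).
  - exact: pgroupS sZP pP.
  - exact: subset_trans sZP sPK.
  - exact: Ohm1_center_neq1 pP ntP.
  exact: char_norm_trans (char_trans (Ohm_char 1 _) (center_char P)) nPX.
have lcK : p_local_cent p K.
  apply: (Thompson_p_complement p_pr odd_p) => Q sylQ.
  have [k Kk defQ] := Sylow_trans sylP sylQ; rewrite defQ ThompsonJJ.
  have normKJ (Y : {set gT}) : 'N_K(Y :^ k) = 'N_K(Y) :^ k.
    by rewrite conjIg conjGid // -normJ.
  split; first by rewrite normKJ; apply: (p_local_centJ k p_pr).
  have -> : 'Ohm_1('Z(P :^ k)) = 'Ohm_1('Z(P)) :^ k.
    by rewrite /center centJ -conjIg OhmJ.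
  by rewrite normKJ; apply: (p_local_centJ k p_pr).
pose N := pprime_gen_group p K.
have p'N : p^'.-group N := Frobenius_pprime_gen lcK.
have nsNK : N <| K := pprime_gen_normal p K.
have nNX : X \subset 'N(N) := subset_trans nKX (pprime_gen_norm p K).
have [N1 | ntN] := eqsVneq N 1.
  have := pprime_gen_quotient K p_pr; rewrite -[pprime_gen p K]/(gval N) N1.
  by rewrite /pgroup -(card_isog (quotient1_isog K)); apply: pgroup_nil.
have nilN : nilpotent N.
  apply: sub_nil => //; rewrite properEneq normal_sub // andbT.
  apply: contraTneq pK => defN; rewrite -p'natE //; move: p'N.
  by rewrite /pgroup defN.
have q_pr : prime (pdiv #|N|) by rewrite pdiv_prime ?cardG_gt1.
set q := pdiv #|N| in q_pr; have hallW := nilpotent_pcore_Hall q nilN.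
have W1 : 'O_q(N) = 1.
  apply: (no_normal q); first exact: pcore_pgroup.
    exact: char_normal_trans (pcore_char q N) nsNK.
  exact: char_norm_trans (pcore_char q N) nNX.
have := pdiv_dvd #|N|; rewrite -/q; apply: contraTT => _.
by rewrite -p'natE // -partn_eq1 // -(card_Hall hallW) /= W1 cards1.
Qed.

(** * Centres of Frobenius complements *)

Section Complement.

Variables (gT : finGroupType) (K H : {group gT}).
Hypotheses (nKH : H \subset 'N(K)) (ntK : K :!=: 1) (regKH : semiregular K H).

(** Every element of K has the form [~ y, t], by counting; and t inverts
    these. *)
Lemma involution_inverts t :
  t \in H -> #[t] = 2 -> {in K, forall k, k ^ t = k^-1}.
Proof.
move=> Ht ot k Kk; have nKt := subsetP nKH t Ht.
have Kt y : y \in K -> y ^ t \in K by move=> Ky; rewrite memJ_norm.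
have t2 y : (y ^ t) ^ t = y by rewrite -conjgM -expg2 -ot expg_order conjg1.
have ntt : t != 1 by rewrite -order_gt1 ot.
have inj : {in K &, injective (fun y => [~ y, t])}.
  move=> y z Ky Kz /= eq_yz.
  have fixt : (z * y^-1) ^ t = z * y^-1.
    have zt : z ^ t = z * (y^-1 * y ^ t).
      by rewrite -commgEl eq_yz commgEl mulKVg.
    by rewrite conjMg conjVg zt [z * _]mulgA mulgK.
  apply/eqP; rewrite eq_sym eq_mulgV1 -in_set1 -[[set _]](regKH (x := t)).
    rewrite inE groupM ?groupV //=; apply/cent1P.
    by apply/commgP/conjg_fixP.
  by rewrite !inE ntt.
have : k \in [set [~ y, t] | y in K].
  suffices -> : [set [~ y, t] | y in K] = K by [].
  apply/eqP; rewrite eqEcard card_in_imset // leqnn andbT.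
  by apply/subsetP=> _ /imsetP[y Ky ->]; rewrite commgEl groupM ?groupV ?Kt.
case/imsetP=> y Ky ->; rewrite commgEl conjMg conjVg t2.
by rewrite [RHS]invMg invgK.
Qed.

(** The product of two involutions of H centralises K, hence is trivial; so the
    involution of H is unique. *)
Lemma even_compl_center : ~~ odd #|H| -> 'Z(H) != 1.
Proof.
rewrite -dvdn2 => /(Cauchy (isT : prime 2))[t Ht ot].
have ntt : t != 1 by rewrite -order_gt1 ot.
have uniq_inv u : u \in H -> #[u] = 2 -> u = t.
  move=> Hu ou; have fixK : K \subset 'C_K[t * u].
    apply/subsetP=> k Kk; rewrite inE Kk; apply/cent1P.
    apply/commgP/conjg_fixP; rewrite conjgM (involution_inverts Ht ot Kk).
    by rewrite (involution_inverts Hu ou) ?groupV ?invgK.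
  have tu1 : t * u = 1.
    apply/eqP; apply: contraNT ntK => nttu; rewrite -subG1.
    by rewrite -(regKH (x := t * u)) // !inE nttu groupM.
  have uV : u^-1 = u.
    by apply/eqP; rewrite eq_invg_mul -expg2 -ou expg_order.
  by apply/esym/eqP; rewrite eq_mulgV1 uV tu1.
apply/trivgPn; exists t => //; rewrite inE Ht; apply/centP=> h Hh.
apply/commgP/conjg_fixP; apply: uniq_inv; first by rewrite groupJ.
by rewrite orderJ.
Qed.

Hypotheses (nilK : nilpotent K) (coKH : coprime #|K| #|H|).

Let V := 'Z(K)%G.
Let abV : abelian V. Proof. exact: center_abelian. Qed.
Let ntV : V :!=: 1. Proof. by rewrite (center_nil_eq1 nilK). Qed.
Let nVH : H \subset 'N(V).
Proof. exact: char_norm_trans (center_char K) nKH. Qed.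
Let coVH : coprime #|V| #|H|.
Proof. exact: coprimeSg (center_sub K) coKH. Qed.
Let regVH : semiregular V H.
Proof. exact: semiregularS (center_sub K) (subxx _) regKH. Qed.

Lemma compl_cent_trivial (Y : {group gT}) :
  Y \subset H -> Y \subset 'C(V) -> Y :=: 1.
Proof.
move=> sYH cYV; apply/trivgP/subsetP=> y Yy; apply: contraR ntV.
rewrite inE => nty; have Hy := subsetP sYH y Yy.
rewrite -subG1 -(regVH (x := y)) ?inE ?nty //.
by rewrite subsetI subxx sub_cent1 (subsetP cYV).
Qed.

(** Otherwise X is semiregular on Y, and the trace argument shows that Y
    centralises V. *)
Lemma compl_prime_cent (X Y : {group gT}) :
    X \subset H -> Y \subset H -> prime #|X| -> prime #|Y| -> X \subset 'N(Y) ->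
  Y \subset 'C(X).
Proof.
move=> sXH sYH pr_X pr_Y nYX; apply/setIidPl/eqP.
apply: contraTT (pr_Y) => /eqP neqCY.
have cYX1 : 'C_Y(X) = 1.
  apply: (prime_TIg pr_Y); apply: contra_notN neqCY => sYC; exact/setIidPl.
have ntX : X :!=: 1 by rewrite -cardG_gt1 prime_gt1.
have cVX1 : 'C_V(X) = 1.
  have [x Xx ntx] := trivgPn _ ntX; apply/trivgP.
  rewrite -(regVH (x := x)) ?inE ?ntx ?(subsetP sXH) // setIS //.
  by rewrite -cent_set1 centS ?sub1set.
rewrite (compl_cent_trivial sYH) ?cards1 //.
apply: (semiregular_TI_cent abV (subset_trans sXH nVH)) => //.
- exact: subset_trans nVH.
- exact: coprimegS coVH.
exact: prime_semiregular.
Qed.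

(** A noncyclic P would contain an elementary abelian E of rank 2, which would
    act faithfully and irreducibly on a minimal E-invariant subgroup of V and
    so be cyclic. *)
Lemma odd_compl_pgroup_cyclic (p : nat) (P : {group gT}) :
  odd #|H| -> P \subset H -> p.-group P -> cyclic P.
Proof.
move=> oddH sPH pP; rewrite (odd_pgroup_rank1_cyclic pP) ?(oddSg sPH) // leqNgt.
apply/p_rank_geP=> [[E /pnElemP[sEP abelE oE]]].
have [pE abE _] := and3P abelE; have sEH := subset_trans sEP sPH.
have [R minR sRV] := minnormal_exists ntV (subset_trans sEH nVH).
have solR : solvable R := abelian_sol (abelianS sRV abV).
have [nRE ntR _] := minnormal_solvable minR (subxx R) solR.
have cER1 : 'C_E(R) = 1.
  apply/trivgP/subsetP=> x /setIP[Ex cRx]; apply: contraR ntR.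
  rewrite inE => ntx; have Hx := subsetP sEH x Ex.
  rewrite -subG1 -(regVH (x := x)) ?inE ?ntx //.
  by rewrite subsetI sRV sub_cent1.
have := minnormal_abelian_cyclic abE solR minR; rewrite cER1.
rewrite -(isog_cyclic (quotient1_isog E)) => cycE.
have ntE : E :!=: 1 by apply: contra_eqN oE => /eqP->; rewrite cards1 logn1.
have oEp := cyclic_abelem_prime abelE cycE ntE.
have p_pr : prime p by have [] := pgroup_pdiv pE ntE.
by move: oE; rewrite oEp logn_prime // eqxx.
Qed.

(** Let p be the least prime divisor of #|H|. Automisers of cyclic p-subgroups
    have order dividing p ^ m * p.-1, so they are p-groups, and H = N * P with
    N a normal p'-subgroup and P cyclic. Let x have order p in P, and let Q be a
    Sylow q-subgroup of N normalised by x; it is cyclic. If [~: Q, <[x]>] were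
    nontrivial, its elements of order q would commute with x by
    compl_prime_cent, against coprime_abel_cent_TI; so x centralises Q. Hence x
    centralises N, as well as P. *)
Lemma odd_compl_center : H :!=: 1 -> odd #|H| -> 'Z(H) != 1.
Proof.
move=> ntH oddH; have p_pr : prime (pdiv #|H|) by rewrite pdiv_prime ?cardG_gt1.
set p := pdiv #|H| in p_pr.
have lcH : p_local_cent p H.
  apply/forall_inP=> X /andP[sXH pX].
  have cycX := odd_compl_pgroup_cyclic oddH sXH pX.
  apply/pgroupP=> q q_pr qNC; rewrite inE /=.
  have leqp : p <= q.
    apply: pdiv_min_dvd; first exact: prime_gt1.
    apply: dvdn_trans qNC _; apply: dvdn_trans (dvdn_quotient _ _) _.
    by rewrite cardSg ?subsetIl.
  have : q %| #|Aut X|.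
    apply: dvdn_trans qNC _.
    rewrite card_quotient ?normal_norm ?subcent_normal //.
    have <- : #|conj_aut X @* 'N_H(X)| = #|'N_H(X) : 'C_H(X)|.
      rewrite card_morphim ker_conj_aut (setIidPr (subsetIr _ _)) -indexgI.
      by rewrite -setIA (setIidPr (cent_sub X)).
    exact: cardSg (Aut_conj_aut X _).
  have [-> | ntX] := eqsVneq X 1.
    by rewrite Aut1 cards1 dvdn1 => /eqP q1; rewrite q1 in q_pr.
  have [_ _ [m oX]] := pgroup_pdiv pX ntX.
  rewrite card_Aut_cyclic // oX totient_pfactor //= Euclid_dvdM //.
  case/orP=> [q_p1 | ]; last first.
    by rewrite Euclid_dvdX // dvdn_prime2 // => /andP[].
  have p1_gt0 : 0 < p.-1 by rewrite -ltnS prednK ?prime_gt0 ?prime_gt1.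
  have := dvdn_leq p1_gt0 q_p1.
  by rewrite -ltnS prednK ?prime_gt0 // ltnNge leqp.
have pH : p %| #|H| := pdiv_dvd _.
have [x Hx ox] := Cauchy p_pr pH.
pose X := <[x]>%G; have sXH : X \subset H by rewrite cycle_subG.
have pX : p.-group X by rewrite /pgroup /= -/(order x) ox pnat_id.
have [P sylP sXP] := Sylow_superset sXH pX; have [sPH pP _] := and3P sylP.
have Px : x \in P by rewrite -cycle_subG.
have pr_X : prime #|X| by rewrite /= -/(order x) ox.
pose N := pprime_gen_group p H.
have p'N : p^'.-group N := Frobenius_pprime_gen lcH.
have [sNH nNH] := andP (pprime_gen_normal p H).
have pHN : p.-group (H / N) := pprime_gen_quotient H p_pr.
have coNX : coprime #|N| #|X|.
  by rewrite /= -/(order x) ox coprime_sym prime_coprime // -p'natE.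
have nNX := subset_trans sXH nNH.
have solX : solvable X := abelian_sol (cycle_abelian x).
have cNX : N \subset 'C(X).
  have cSyl q : prime q ->
      exists2 Q : {group gT}, q.-Sylow(N) Q & Q \subset 'C(X).
    move=> q_pr.
    have [Q sylQ nQX] := sol_coprime_Sylow_exists q solX nNX coNX.
    have [sQN qQ _] := and3P sylQ; exists Q => //.
    have sQH := subset_trans sQN sNH.
    have cycQ := odd_compl_pgroup_cyclic oddH sQH qQ.
    have abQ := cyclic_abelian cycQ.
    have coQX := coprimeSg sQN coNX.
    have tiR := coprime_abel_cent_TI nQX coQX abQ.
    apply/commG1P/eqP; apply: contraT => ntR.
    have sRQ : [~: Q, X] \subset Q by rewrite commg_subl.
    have [_ qR _] := pgroup_pdiv (pgroupS sRQ qQ) ntR.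
    have [z Rz oz] := Cauchy q_pr qR; have Qz := subsetP sRQ z Rz.
    have ntz : z != 1 by rewrite -order_gt1 oz prime_gt1.
    case/negP: ntz; rewrite -in_set1 -[[set 1]]tiR inE Rz.
    rewrite -cycle_subG; apply: compl_prime_cent => //.
    - by rewrite cycle_subG (subsetP sQH).
    - by rewrite /= -/(order z) oz.
    apply: char_norm_trans nQX; rewrite sub_cyclic_char //.
    by rewrite cycle_subG.
  apply/setIidPl/eqP; rewrite eqEsubset subsetIl /= -indexg_eq1.
  apply: contraT => neq1; set n := #|_ : _| in neq1.
  have q_pr : prime (pdiv n).
    by rewrite pdiv_prime // ltn_neqAle eq_sym neq1 indexg_gt0.
  have [Q /and3P[sQN _ q'NQ] cQX] := cSyl _ q_pr.
  have := pdiv_dvd n; rewrite -[_ %| _]negbK -p'natE // => /negP[].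
  by apply: pnat_dvd q'NQ; rewrite indexgS // subsetI sQN.
apply/trivgPn; exists x; last by rewrite -order_gt1 ox prime_gt1.
have defH : N * P = H.
  apply/eqP; rewrite eqEsubset mulG_subG sNH sPH /= -quotientSK //.
  by rewrite (pHall_id (quotient_pHall (subset_trans sPH nNH) sylP) pHN).
rewrite inE Hx -defH centM; apply/setIP; split.
  by rewrite -cycle_subG centsC.
apply: (subsetP _ x Px).
exact: cyclic_abelian (odd_compl_pgroup_cyclic oddH sPH pP).
Qed.

End Complement.

(** * The divisibility graph of a Frobenius group *)

Lemma n_comp_two (T : finType) (e : rel T) (S : {pred T}) (a b : T) :
    symmetric e -> closed e S -> a \in S -> b \notin S ->
    (forall v, v \in S -> connect e a v) ->
    (forall v, v \notin S -> connect e b v) ->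
  n_comp e T = 2%N.
Proof.
move=> sym_e clS Sa Sb conS conS'.
have csym : connect_sym e := sym_connect_sym sym_e.
rewrite (n_compC S); have -> : n_comp e S = 1%N.
  rewrite -(n_comp_connect csym a); apply: eq_n_comp_r => v.
  apply/idP/idP=> [/conS // | av].
  by rewrite -(closed_connect clS av).
suffices -> : n_comp e [predC S] = 1%N by [].
rewrite -(n_comp_connect csym b); apply: eq_n_comp_r => v.
rewrite inE /=; apply/idP/idP=> [/conS' // | bv].
by rewrite -(closed_connect clS bv).
Qed.

Section FrobeniusGroup.

Variables (gT : finGroupType) (G K H : {group gT}).
Hypothesis frobG : [Frobenius G = K ><| H].

Lemma Frobenius_ker_nilpotent : nilpotent K.
Proof.
have [defG ntK ntH _ _] := Frobenius_context frobG.
have [_ _ nKH _] := sdprodP defG.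
have pr_r : prime (pdiv #|H|) by rewrite pdiv_prime ?cardG_gt1.
have [x Hx ox] := Cauchy pr_r (pdiv_dvd _).
have sXH : <[x]> \subset H by rewrite cycle_subG.
apply: (@Thompson_kernel_nilpotent _ K <[x]>%G).
- exact: subset_trans sXH nKH.
- by rewrite /= -/(order x) ox.
- exact: coprimegS sXH (Frobenius_coprime frobG).
rewrite /= cent_cycle; apply: (Frobenius_reg_ker frobG).
by rewrite !inE Hx -order_gt1 ox prime_gt1.
Qed.

Lemma Frobenius_ker_center : 'Z(K) != 1.
Proof.
have [_ ntK _ _ _] := Frobenius_context frobG.
by rewrite (center_nil_eq1 Frobenius_ker_nilpotent).
Qed.

Lemma Frobenius_compl_center : 'Z(H) != 1.
Proof.
have [defG ntK ntH _ _] := Frobenius_context frobG.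
have [_ _ nKH _] := sdprodP defG; have regKH := Frobenius_reg_ker frobG.
have [oddH | evenH] := boolP (odd #|H|).
  exact: odd_compl_center nKH ntK regKH Frobenius_ker_nilpotent
    (Frobenius_coprime frobG) ntH oddH.
exact: even_compl_center nKH ntK regKH evenH.
Qed.

Lemma index_ker : #|G : K| = #|H|.
Proof.
have [defG _ _ /proper_sub sKG _] := Frobenius_context frobG.
by rewrite -divgS // -(sdprod_card defG) mulKn.
Qed.

Lemma index_compl : #|G : H| = #|K|.
Proof.
have [defG _ _ _ /proper_sub sHG] := Frobenius_context frobG.
by rewrite -divgS // -(sdprod_card defG) mulnK.
Qed.

Lemma cent1_ker x : x \in K^# -> 'C_G[x] \subset K.
Proof. exact: (Frobenius_cent1_ker frobG). Qed.

Lemma cent1_compl x : x \in H^# -> 'C_G[x] \subset H.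
Proof.
by have /andP[_ /andP[_ /cent1_normedTI]] := frobG; apply.
Qed.

Lemma class_size_ker x : x \in K^# -> #|H| %| #|x ^: G|.
Proof.
move=> Kx; rewrite -index_cent1 -index_ker; apply: indexgS; exact: cent1_ker.
Qed.

Lemma class_size_compl x : x \in G -> x \notin K -> #|K| %| #|x ^: G|.
Proof.
move=> Gx K'x; have /and3P[/eqP defG _ _] := Frobenius_partition frobG.
have [_ _ _ /proper_sub sKG _] := Frobenius_context frobG.
have := Gx; rewrite -{1}defG => /bigcupP[B]; rewrite !inE.
case/orP=> [/eqP-> Kx | /imsetP[k Kk ->]]; first by rewrite Kx in K'x.
rewrite -[x](conjgKV k) memJ_conjg => Hh; have Gk := subsetP sKG k Kk.
rewrite classGidl // -index_cent1 -index_compl; apply: indexgS.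
exact: cent1_compl.
Qed.

End FrobeniusGroup.

Lemma central_class_size (gT : finGroupType) (G L : {group gT}) z :
  z \in 'Z(L) -> L \subset G -> 'C_G[z] \subset L -> #|z ^: G| = #|G : L|.
Proof.
case/setIP=> Lz cLz sLG sCL; rewrite -index_cent1; congr #|_ : _|.
by apply/eqP; rewrite eqEsubset sCL subsetI sLG sub_cent1.
Qed.

Theorem theoremA1 (gT : finGroupType) (G K H : {group gT})
    (frobG : [Frobenius G = K ><| H]%g) :
  div_graph_ncomp (cs G) = 2.
Proof.
have [defG ntK ntH prKG prHG] := Frobenius_context frobG.
have [sKG sHG] := (proper_sub prKG, proper_sub prHG).
have coKH := Frobenius_coprime frobG.
have csP n : reflect (exists2 x, x \in G & n = #|x ^: G|) (n \in cs G).
  by apply: (iffP (imfsetP _ _ _ _)) => [[x /= Gx ->]|[x Gx ->]]; exists x.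
have H_gt1 : 1 < #|H| by rewrite cardG_gt1.
have K_gt1 : 1 < #|K| by rewrite cardG_gt1.
have csH : #|H| \in (cs G `\ 1%N)%fset.
  have [z Zz ntz] := trivgPn _ (Frobenius_ker_center frobG).
  have [Kz _] := setIP Zz; rewrite !inE gtn_eqF //=.
  apply/csP; exists z; first exact: subsetP sKG z Kz.
  rewrite (central_class_size Zz) ?(index_ker frobG) //.
  by apply: (cent1_ker frobG); rewrite !inE ntz.
have csK : #|K| \in (cs G `\ 1%N)%fset.
  have [z Zz ntz] := trivgPn _ (Frobenius_compl_center frobG).
  have [Hz _] := setIP Zz; rewrite !inE gtn_eqF //=.
  apply/csP; exists z; first exact: subsetP sHG z Hz.
  rewrite (central_class_size Zz) ?(index_compl frobG) //.
  by apply: (cent1_compl frobG); rewrite !inE ntz.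
pose a : div_vertex (cs G) := [` csH]%fset.
pose b : div_vertex (cs G) := [` csK]%fset.
pose S := [pred v : div_vertex (cs G) | #|H| %| val v].
have dv (v : div_vertex (cs G)) : exists2 x, x \in G^# & val v = #|x ^: G|.
  have := valP v; rewrite !inE => /andP[v1 /csP[x Gx def_v]].
  exists x => //; rewrite !inE Gx andbT; apply: contraNneq v1 => x1.
  by rewrite def_v x1 class1G cards1.
have SorK (v : div_vertex (cs G)) : v \notin S -> #|K| %| val v.
  rewrite inE; have [x /setD1P[ntx Gx] ->] := dv v.
  have [Kx | K'x _] := boolP (x \in K).
    by rewrite (class_size_ker frobG) // !inE ntx.
  exact: class_size_compl frobG _ Gx K'x.
have SnotK (v : div_vertex (cs G)) : v \in S -> ~~ (#|K| %| val v).
  rewrite inE => Hv; apply/negP=> Kv.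
  have [x /setD1P[ntx Gx] def_v] := dv v.
  have : #|G| %| val v by rewrite -(sdprod_card defG) Gauss_dvd ?Kv.
  rewrite def_v -index_cent1 -(Lagrange (subsetIl G 'C[x])) /=.
  rewrite -[X in _ %| X]mul1n dvdn_pmul2r ?indexg_gt0 // dvdn1.
  apply/negP; rewrite -trivg_card1; apply: contra ntx => /eqP C1.
  by rewrite -in_set1 -[[set _]]C1 inE Gx cent1id.
apply: (@n_comp_two _ _ S a b).
- by move=> u v; rewrite /div_edge /= eq_sym orbC.
- apply: intro_closed.
    by apply: sym_connect_sym => u v; rewrite /div_edge /= eq_sym orbC.
  move=> u v /andP[_ /orP[uv | vu]] Su.
    by rewrite inE (dvdn_trans _ uv).
  apply: contraT => /SorK Kv; case/negP: (SnotK u Su).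
  exact: dvdn_trans Kv vu.
- by rewrite inE /=.
- by apply/negP => /SnotK; rewrite /= dvdnn.
- move=> v Sv; have [<- | neq] := eqVneq a v; first exact: connect0.
  rewrite inE in Sv; apply: connect1; rewrite /div_edge /= neq.
  by rewrite /= Sv.
move=> v S'v; have [<- | neq] := eqVneq b v; first exact: connect0.
by apply: connect1; rewrite /div_edge /= neq /= (SorK v S'v).
Qed.
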